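(* Consider the system $\dot x=f(x)+u\,g(x)$, $(x,u)\in\mathbb{R}^n\times\mathbb{R}$, with $f(0)=0$, where $f,g:\mathbb{R}^n\to\mathbb{R}^n$ are $C^2$. Assume that there exists a $C^2$, positive definite and proper function $\Phi:\mathbb{R}^n\to\mathbb{R}^+$ such that for every $x\in\mathbb{R}^n$ the following implication holds: $$(g\Phi)(x)=0,\ x\ne0\ \Longrightarrow\ \begin{cases}\text{either }(f\Phi)(x)<0,\\ \text{or }(f\Phi)(x)=0\text{ and }([f,g]\Phi)(x)\neq0.\end{cases}$$ Then the system $\dot x=f(x)+u\,g(x)$ is SDF-WGAS.
   Context: $\mathbb{R}^+=[0,\infty)$. For $C^1$ maps $X:\mathbb{R}^n\to\mathbb{R}^n$ and $Y$ (vector- or scalar-valued) on $\mathbb{R}^n$, $XY:=DY\,X$; so $X\Phi=D\Phi\,X$ is the Lie derivative of $\Phi$ along $X$. $[\cdot,\cdot]$ is the Lie bracket of vector fields, with $[X,Y]\Phi=X(Y\Phi)-Y(X\Phi)$. Controls are measurable and essentially bounded. For a system $\dot x=F(x,u)$, $(x,u)\in\mathbb{R}^n\times\mathbb{R}^\ell$, $F(0,0)=0$ (here $\ell=1$, $F(x,u)=f(x)+ug(x)$), $\pi(\cdot,s,x_0,u)$ denotes the trajectory with $\pi(s,s,x_0,u)=x_0$ corresponding to the control $u$. Definition (SDF-WGAS). The system $\dot x=F(x,u)$ is Weakly Globally Asymptotically Stabilizable by Sampled-Data Feedback (SDF-WGAS) if for any constant $\sigma>0$ there exist a map $T:\mathbb{R}^n\to\mathbb{R}^+$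 with $T(0)=0$ and $T(x)\le\sigma$ for all $x\in\mathbb{R}^n\setminus\{0\}$, and a map $\varphi=\varphi(t,s,x):\mathbb{R}^+\times\mathbb{R}^+\times\mathbb{R}^n\to\mathbb{R}^\ell$ with $\varphi(\cdot,\cdot,0)=0$, measurable and essentially bounded with respect to the first two variables, such that for every $x_0\ne0$ a sequence of times $t_0:=0<t_1<t_2<\cdots<t_\nu<\cdots$, $t_\nu\to\infty$, can be found in such a way that, if $$u_{x_0}(t):=\varphi(t,t_i,\pi(t_i)),\ t\in[t_i,t_{i+1}),\ i=0,1,2,\ldots;\quad \pi(t_i):=\pi(t_i,t_{i-1},\pi(t_{i-1}),u_{x_0}),\ i=1,2,\ldots;\quad \pi(t_0):=x_0,$$ then $t_{i+1}-t_i=T(\pi(t_i))$, $i=0,1,2,\ldots$, and the system $\dot x(t)=F(x(t),u_{x_0}(t))$, $t\in[t_i,t_{i+1})$, has solution $\pi(t,0,x_0,u_{x_0})$ existing for all $t\ge0$ with the properties: Stability: $\forall\varepsilon>0\ \exists\delta=\delta(\varepsilon)>0$: $|x_0|\le\delta\Rightarrow|\pi(t,0,x_0,u_{x_0})|\le\varepsilon$ for all $t\ge0$; Attractivity: $\lim_{t\to\infty}\pi(t,0,x_0,u_{x_0})=0$ for all $x_0\in\mathbb{R}^n$. *)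

(* Defs.v *)
From mathcomp Require Export all_boot all_order all_algebra.
From mathcomp Require Export all_classical all_reals all_analysis.
Export Order.TTheory GRing.Theory Num.Theory numFieldNormedType.Exports.

Set Implicit Arguments.
Unset Strict Implicit.
Unset Printing Implicit Defensive.

#[global] Open Scope classical_set_scope.
#[global] Open Scope ring_scope.

Section Calculus.
Context {R : realType} {n : nat}.

(* On a finite-dimensional space, continuity of x |-> 'D_v Y x for every fixed
   v is continuity of the derivative in the operator norm. *)
Fixpoint is_Ck {W : normedModType R} (k : nat) (Y : 'rV[R]_n -> W) : Prop :=
  if k is k'.+1 then
    (forall x, differentiable Y x) /\ forall v, is_Ck k' (fun x => 'D_v Y x)
  else continuous Y.

Definition lie_derivative {W : normedModType R}
    (X : 'rV[R]_n -> 'rV[R]_n) (Y : 'rV[R]_n -> W) : 'rV[R]_n -> W :=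
  fun x => 'd Y x (X x).

(* Sign convention: lie_derivative (lie_bracket X Y) Phi
   = X (Y Phi) - Y (X Phi) for Phi of class C^2. *)
Definition lie_bracket (X Y : 'rV[R]_n -> 'rV[R]_n) : 'rV[R]_n -> 'rV[R]_n :=
  fun x => lie_derivative X Y x - lie_derivative Y X x.

Definition positive_definite (Phi : 'rV[R]_n -> R) : Prop :=
  Phi 0 = 0 /\ forall x, x != 0 -> 0 < Phi x.

Definition proper_map (Phi : 'rV[R]_n -> R) : Prop :=
  forall K : set R, compact K -> compact (Phi @^-1` K).

End Calculus.

Section SampledData.
Context {R : realType} {n l : nat}.

Let mu := @lebesgue_measure R.

Definition essentially_bounded {d} {E : measurableType d}
    (m : {measure set E -> \bar R}) (D : set E) (w : E -> 'rV[R]_l) : Prop :=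
  exists M : R, {ae m, forall z, D z -> `|w z| <= M}.

Definition measurable_vec {d} {E : measurableType d}
    (D : set E) (w : E -> 'rV[R]_l) : Prop :=
  forall j, measurable_fun D (fun z => w z 0 j).

(* Only local essential boundedness can be asked on [s, +oo[: for
   x' = x + u x^3 any stabilizing u is unbounded as x tends to 0. *)
Definition is_control (s : R) (u : R -> 'rV[R]_l) : Prop :=
  measurable_vec `[s, +oo[ u /\
  forall b, essentially_bounded mu `[s, b] u.

(* x = pi(., s, x0, u) on [s, +oo[, as a Caratheodory solution of
   x' = F(x, u). *)
Definition is_trajectory (F : 'rV[R]_n -> 'rV[R]_l -> 'rV[R]_n)
    (s : R) (x0 : 'rV[R]_n) (u : R -> 'rV[R]_l) (x : R -> 'rV[R]_n) : Prop :=
  is_control s u /\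
  forall t i, s <= t ->
    mu.-integrable `[s, t] (EFin \o (fun r => F (x r) (u r) 0 i)) /\
    x t 0 i = x0 0 i + \int[mu]_(r in `[s, t]) (F (x r) (u r) 0 i).

Definition sampled_trajectory (F : 'rV[R]_n -> 'rV[R]_l -> 'rV[R]_n)
    (T : 'rV[R]_n -> R) (phi : R -> R -> 'rV[R]_n -> 'rV[R]_l)
    (x0 : 'rV[R]_n) (t : nat -> R) (x : R -> 'rV[R]_n) : Prop :=
  [/\ t 0%N = 0, (forall i, t i < t i.+1), t i @[i --> \oo] --> +oo,
      (forall i, t i.+1 - t i = T (x (t i))) &
      exists2 u : R -> 'rV[R]_l,
        (forall i r, t i <= r < t i.+1 -> u r = phi r (t i) (x (t i))) &
        is_trajectory F 0 x0 u x].

Let quadrant : set (measurableTypeR R * measurableTypeR R) :=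
  `[0, +oo[ `*` `[0, +oo[.

Definition sdf_wgas (F : 'rV[R]_n -> 'rV[R]_l -> 'rV[R]_n) : Prop :=
  forall sigma : R, 0 < sigma ->
  exists (T : 'rV[R]_n -> R) (phi : R -> R -> 'rV[R]_n -> 'rV[R]_l),
  [/\ (forall x, 0 <= T x), T 0 = 0, (forall x, x != 0 -> T x <= sigma),
      (forall t s, 0 <= t -> 0 <= s -> phi t s 0 = 0) &
      forall x,
        measurable_vec quadrant (fun ts => phi ts.1 ts.2 x) /\
        essentially_bounded (mu \x mu)%E quadrant
          (fun ts => phi ts.1 ts.2 x)] /\
  exists (t : 'rV[R]_n -> nat -> R) (sol : 'rV[R]_n -> R -> 'rV[R]_n),
  [/\ (forall x0, x0 != 0 -> sampled_trajectory F T phi x0 (t x0) (sol x0)),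
      (* T 0 = 0 rules out a sampling sequence from the equilibrium, where
         the feedback vanishes. *)
      is_trajectory F 0 0 (fun=> 0) (sol 0),
      (forall eps : R, 0 < eps -> exists2 delta : R, 0 < delta &
        forall x0, `|x0| <= delta -> forall r, 0 <= r -> `|sol x0 r| <= eps) &
      forall x0, sol x0 r @[r --> +oo] --> (0 : 'rV[R]_n)].

End SampledData.

(* Main.v *)
Require Import Defs.
From mathcomp Require Import measurable_realfun ring lra.

(** The sampling period is the constant [sigma], except at the origin; all the
    freedom of the definition goes into the controls used on each period.

    Descent.  Around every [p != 0] some control lowers [Phi] by a fixed amount,
    uniformly in the initial state close to [p] ([descends_everywhere]).  If
    [g Phi <> 0] at [p], or [f Phi < 0], a constant control does it
    ([descends_drift]).  If [f Phi = g Phi = 0], apply [v] during a time [s] and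
    then [- v] during a time [s]: the first-order terms cancel up to
    [2 s (f Phi)(q)], small for [q] near [p], and the term in [s ^ 2] is
    [2 f (f Phi) - v [f,g] Phi], which a suitable [v] makes equal to [- 4]
    ([descends_bracket]); the bracket appears because second derivatives of
    [Phi] are symmetric ([schwarz], [lie_bracketE]).  Compactness of the sets
    [c <= Phi <= Phi x] then gives a finite chain of descents from [x] to any
    sublevel set [Phi <= c], along which [Phi] hardly exceeds [Phi x] and the
    origin is avoided ([steer_to_sublevel]).

    Spending time.  The descents might accumulate: infinitely many of them could
    take a finite total time.  Under the zero control, however, the norm of the
    state changes at most by a constant factor in time [sigma], because [f] is
    Lipschitz and vanishes at the origin; a state with [Phi] small enough can
    thus wait up to time [sigma] at nonzero states with [Phi] still small
    ([coast]).  Fix levels [c 0 > c 1 > ...] tending to [0] such that waiting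
    from [Phi <= c k.+1] stays in [Phi < c k].

    One period.  Let [k] be the largest index with [Phi x < c k], or [0] if
    there is none, and let [N] be the least number of periods in which [x] can
    be brought to [Phi <= c k.+2] while remaining in [Phi < c k] (without this
    constraint when [k = 0]) and away from the origin.  If [N <= 1],
    go there and wait until the end of the period: the period ends in
    [Phi < c k.+1], so [k] has increased.  Otherwise follow a plan of length
    at most [N] periods during one period: [k] has not decreased, and if it is
    unchanged then [N] has decreased ([ranked_step]).  Hence [k] never
    decreases and tends to infinity, which is both stability and attractivity,
    and it does so along the unbounded sampling times [i * sigma].

    The open-loop control of a period is chosen as a function of its index [i]
    and of the state at its beginning.  Read as a feedback [phi t s x], it is
    nonzero only for [s] in the countable set of multiples of [sigma], so it is
    measurable and essentially bounded ([feedback_measurable],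
    [feedback_essentially_bounded]). *)

Set Implicit Arguments.
Unset Strict Implicit.
Unset Printing Implicit Defensive.


(** * Integrals over half-open intervals *)

Section IntervalIntegrals.
Context {R : realType}.
Notation mu := (@lebesgue_measure R).
Implicit Types (h : R -> R) (a b c : R).

Lemma continuous_integrable_co h a b :
  continuous h -> mu.-integrable `[a, b[ (EFin \o h).
Proof.
move=> hc; have : mu.-integrable `[a, b] (EFin \o h).
  apply: continuous_compact_integrable; first exact: segment_compact.
  exact: continuous_subspaceT.
by apply: integrableS => //; apply: subset_itvl; rewrite bnd_simp.
Qed.

Lemma Rintegral_co_split h a b c : a <= b -> b <= c ->
  mu.-integrable `[a, c[ (EFin \o h) ->
  \int[mu]_(r in `[a, c[) h r =
  \int[mu]_(r in `[a, b[) h r + \int[mu]_(r in `[b, c[) h r.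
Proof.
move=> ab bc hi.
have E : `[a, c[%classic = `[a, b[ `|` `[b, c[ :> set R.
  by rewrite -itv_bndbnd_setU// bnd_simp.
rewrite E Rintegral_setU//; first by rewrite -E.
apply/disj_setPS => y [/=]; rewrite 2!in_itv/= => /andP[_ yb] /andP[].
by rewrite leNgt yb.
Qed.

Lemma Rintegral_co_le h a b M : a <= b ->
  mu.-integrable `[a, b[ (EFin \o h) ->
  (forall r, a <= r < b -> `|h r| <= M) ->
  `|\int[mu]_(r in `[a, b[) h r| <= M * (b - a).
Proof.
move=> ab hi hM.
apply: le_trans (le_normr_Rintegral _ hi) _ => //.
have E : \int[mu]_(r in `[a, b[) M = M * (b - a).
  rewrite Rintegral_cst//= lebesgue_measure_itv/= lte_fin.
  by case: ltP => //= ba; have /eqP -> : b == a; rewrite ?subrr// eq_le ba ab.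
rewrite -E; apply: le_Rintegral => //=.
- by have := integrable_norm hi.
- exact: continuous_integrable_co (@cst_continuous _ _ _).
Qed.

End IntervalIntegrals.

(** * Row vectors and Lipschitz maps *)

Section RowVectors.
Context {R : realType} {n : nat}.
Implicit Types v : 'rV[R]_n.

Lemma rV_norm_le v (c : R) : 0 <= c -> (forall i, `|v 0 i| <= c) -> `|v| <= c.
Proof.
move=> c0 vc; rewrite [leLHS]/Num.Def.normr/= mx_normrE.
by apply: bigmax_le => //= -[i j] _ /=; rewrite ord1.
Qed.

Lemma rV_coord_le v i : `|v 0 i| <= `|v|.
Proof.
by rewrite [leRHS]/Num.Def.normr/= mx_normrE; exact: (le_bigmax _ _ (0, i)).
Qed.

Lemma continuous_coord (T : topologicalType) (y : T -> 'rV[R]_n) i :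
  continuous y -> continuous (fun t => y t 0 i).
Proof.
move=> yc t; apply: (@continuous_comp _ _ _ y (fun v : 'rV[R]_n => v 0 i)).
  exact: yc.
exact: coord_continuous.
Qed.

Lemma lipschitz_continuous (W V : normedModType R) (y : W -> V) (K : R) :
  (forall s t, `|y s - y t| <= K * `|s - t|) -> continuous y.
Proof.
move=> yK t; apply/cvgrPdist_lt => e e0; near=> s.
rewrite (le_lt_trans (yK _ _))//.
apply: (@le_lt_trans _ _ ((`|K| + 1) * `|t - s|)).
  by rewrite ler_wpM2r// ler_wpDr// ler_norm.
rewrite mulrC -ltr_pdivlMr ?ltr_wpDl//.
by near: s; apply: cvgr_dist_lt => //; rewrite divr_gt0// ltr_wpDl.
Unshelve. all: by end_near. Qed.

End RowVectors.

(** * The Picard-Lindelof theorem *)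

Section Clamp.
Context {R : realType}.
Implicit Types a b s t : R.

Definition clamp a b t := Num.max a (Num.min t b).

Lemma clamp_itv a b t : a <= b -> a <= clamp a b t <= b.
Proof. by move=> ab; rewrite /clamp le_max lexx/= ge_max ab ge_min lexx orbT. Qed.

Lemma clamp_id a b t : a <= t <= b -> clamp a b t = t.
Proof. by move=> /andP[at_ tb]; rewrite /clamp (min_idPl _)// (max_idPr _). Qed.

Lemma clamp_lip a b s t : `|clamp a b s - clamp a b t| <= `|s - t|.
Proof.
rewrite /clamp; have := ler_norm (s - t); have := ler_norm (t - s).
rewrite (distrC t) ler_norml.
case: (leP s b) => ?; case: (leP t b) => ?.
- by case: (leP a s) => ?; case: (leP a t) => ? ? ?; apply/andP; split; lra.
- by case: (leP a s) => ?; case: (leP a b) => ? ? ?; apply/andP; split; lra.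
- by case: (leP a b) => ?; case: (leP a t) => ? ? ?; apply/andP; split; lra.
- by case: (leP a b) => ? ? ?; apply/andP; split; lra.
Qed.

End Clamp.

Section Picard.
Context {R : realType} {n : nat}.
Notation mu := (@lebesgue_measure R).
Variables (X : 'rV[R]_n -> 'rV[R]_n) (q : 'rV[R]_n) (r M L a d : R).
Hypotheses (M0 : 0 <= M) (L0 : 0 <= L) (d0 : 0 <= d).
Hypothesis Xc : continuous X.
Hypothesis XM : forall z, `|z - q| <= r -> `|X z| <= M.
Hypothesis XL : forall z w, `|z - q| <= r -> `|w - q| <= r ->
  `|X z - X w| <= L * `|z - w|.
Hypotheses (dM : d * M <= r) (dL : d * L <= 2^-1).

Let good (y : R -> 'rV[R]_n) :=
  (forall t, `|y t - q| <= r) /\ (forall s t, `|y s - y t| <= M * `|s - t|).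

(* Clamping time to [[a, a + d]] makes every iterate a function on all of [R],
   so that continuity and Lipschitz bounds hold without restriction. *)
Let P (y : R -> 'rV[R]_n) (t : R) : 'rV[R]_n :=
  \row_i (q 0 i + \int[mu]_(s in `[a, clamp a (a + d) t[) (X (y s) 0 i)).

Let r0 : 0 <= r. Proof. by apply: le_trans dM; rewrite mulr_ge0. Qed.

Let Xyc y i : good y -> continuous (fun s => X (y s) 0 i).
Proof.
move=> [_ yM]; apply: (@continuous_coord R n R (fun s => X (y s))) => t.
by apply: continuous_comp; [exact: (lipschitz_continuous yM)|exact: Xc].
Qed.

Let Xyi y b c i : good y ->
  mu.-integrable `[b, c[ (EFin \o (fun s => X (y s) 0 i)).
Proof. by move=> gy; apply: continuous_integrable_co; exact: Xyc. Qed.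

Let good_P y : good y -> good (P y).
Proof.
move=> gy; have [yq _] := gy.
have ad : a <= a + d by rewrite lerDl.
split=> [t|].
  apply: rV_norm_le => // i; rewrite !mxE addrAC subrr add0r.
  have /andP[ct1 ct2] := clamp_itv t ad.
  apply: (le_trans (Rintegral_co_le (M:=M) ct1 (Xyi _ _ _ gy) _)).
    by move=> s _; rewrite (le_trans (rV_coord_le _ _))// XM.
  by rewrite (le_trans _ dM)// mulrC ler_wpM2r// lerBlDl.
have H s t : s <= t -> `|P y s - P y t| <= M * `|s - t|.
  move=> st; apply: rV_norm_le => [|i]; first by rewrite mulr_ge0.
  rewrite !mxE opprD addrACA subrr add0r.
  have /andP[cs1 cs2] := clamp_itv s ad.
  have /andP[ct1 ct2] := clamp_itv t ad.
  have cst : clamp a (a + d) s <= clamp a (a + d) t.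
    by rewrite /clamp ge_max !le_max lexx/= le_min !ge_min st lexx !orbT.
  rewrite (Rintegral_co_split cs1 cst)//; last exact: Xyi.
  rewrite opprD addrA subrr add0r normrN.
  apply: (le_trans (Rintegral_co_le (M:=M) cst (Xyi _ _ _ gy) _)).
    by move=> x _; rewrite (le_trans (rV_coord_le _ _))// XM.
  rewrite ler_wpM2l// -[leLHS]ger0_norm ?subr_ge0// (distrC s).
  exact: clamp_lip.
move=> s t; have [/H//|/ltW/H] := leP s t.
by rewrite distrC (distrC t).
Qed.

Let contr_P y z D : good y -> good z -> (forall t, `|y t - z t| <= D) ->
  forall t, `|P y t - P z t| <= D / 2.
Proof.
move=> gy gz yz t.
have ad : a <= a + d by rewrite lerDl.
have /andP[ct1 ct2] := clamp_itv t ad.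
have D0 : 0 <= D by rewrite (le_trans _ (yz 0)).
apply: rV_norm_le => [|i]; first by rewrite divr_ge0.
rewrite !mxE opprD addrACA subrr add0r -RintegralB//; [|exact: Xyi|exact: Xyi].
have yzi : mu.-integrable `[a, clamp a (a + d) t[
    (EFin \o (fun s => X (y s) 0 i - X (z s) 0 i)).
  by apply: continuous_integrable_co => s; apply: continuousB; exact: Xyc.
apply: (le_trans (Rintegral_co_le (M:=L * D) ct1 yzi _)).
  move=> s _; have := rV_coord_le (X (y s) - X (z s)) i.
  rewrite !mxE => /le_trans -> //.
  by rewrite (le_trans (XL _ _))//; [exact: gy.1|exact: gz.1|rewrite ler_wpM2l].
apply: (@le_trans _ _ (L * D * d)).
  by rewrite ler_wpM2l ?mulr_ge0// lerBlDl.
have : d * L * D <= 2^-1 * D by rewrite ler_wpM2r.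
lra.
Qed.

Let it k := iter k P (fun=> q).

Let good_it k : good (it k).
Proof.
elim: k => [|k IH]; last exact: good_P.
by split=> [t|s t]; rewrite subrr normr0// mulr_ge0.
Qed.

Let it_step k t : `|it k.+1 t - it k t| <= r / 2 ^+ k.
Proof.
elim: k t => [|k IH] t; first by rewrite expr0 divr1 (good_it 1).1.
rewrite exprSr invfM mulrA.
by apply: contr_P IH t; exact: good_it.
Qed.

Let it_dist k m t : `|it (k + m) t - it k t| <= 2 * r / 2 ^+ k.
Proof.
have : `|it (k + m) t - it k t| <= 2 * r / 2 ^+ k - 2 * r / 2 ^+ (k + m).
  elim: m => [|m IH]; first by rewrite addn0 !subrr normr0.
  have := it_step (k + m) t; rewrite -addnS => H.
  rewrite -(subrKA (it (k + m) t)) (le_trans (ler_normD _ _))//.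
  rewrite (le_trans (lerD H IH))//.
  rewrite addnS exprS invfM.
  lra.
move=> /le_trans; apply; rewrite lerBlDr lerDl divr_ge0 ?exprn_ge0//.
by rewrite mulr_ge0.
Qed.

Let half_cvg0 (C : R) : C / 2 ^+ k @[k --> \oo] --> (0 : R).
Proof.
have := cvg_geometric C (_ : `|2^-1 : R| < 1).
under [X in _ -> X @ _ --> _]eq_fun => k do rewrite -exprVn.
by apply; rewrite ger0_norm// invf_lt1// ltr1n.
Qed.

Let it_cvg t : cvg (it k t @[k --> \oo]).
Proof.
apply/cauchy_cvgP/cauchy_exP => e e0.
have /cvgrPdist_lt/(_ _ e0) [N _ HN] := half_cvg0 (2 * r).
exists (it N t), N => // k /= Nk.
rewrite -ball_normE /ball_/= distrC -(subnKC Nk) (le_lt_trans (it_dist _ _ _))//.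
by have := HN N (leqnn N); rewrite sub0r normrN; apply: le_lt_trans; exact: ler_norm.
Qed.

Let y t := lim (it k t @[k --> \oo]).

Let y_dist k t : `|y t - it k t| <= 2 * r / 2 ^+ k.
Proof.
have H : (it m t - it k t) @[m --> \oo] --> y t - it k t.
  by apply: cvgB; [exact: it_cvg|exact: cvg_cst].
apply: (cvgr_to_le (cvg_norm H)).
by exists k => // m /= km; rewrite -(subnKC km); exact: it_dist.
Qed.

Let good_y : good y.
Proof.
split=> [t|s t].
  have H : (it k t - q) @[k --> \oo] --> y t - q.
    by apply: cvgB; [exact: it_cvg|exact: cvg_cst].
  apply: (cvgr_to_le (cvg_norm H)).
  by exists 0%N => // k _; exact: (good_it k).1.
have H : (it k s - it k t) @[k --> \oo] --> y s - y t.
  by apply: cvgB; exact: it_cvg.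
apply: (cvgr_to_le (cvg_norm H)).
by exists 0%N => // k _; exact: (good_it k).2.
Qed.

Let y_fix t : y t = P y t.
Proof.
apply/eqP; rewrite -subr_eq0 -normr_le0.
apply: (cvgr_to_ge (half_cvg0 (2 * r))).
exists 0%N => // k _.
have H1 : `|y t - it k.+1 t| <= _ := y_dist k.+1 t.
have H2 : `|P y t - P (it k) t| <= _ :=
  contr_P good_y (good_it k) (y_dist k) t.
rewrite -(subrKA (it k.+1 t)) (le_trans (ler_normD _ _))//.
rewrite (distrC (it k.+1 t)) (le_trans (lerD H1 H2))//.
rewrite exprS invfM; lra.
Qed.

(** The Picard operator preserves the [M]-Lipschitz curves that stay in the
    ball, because [d * M <= r], and halves uniform distances, because
    [d * L <= 1 / 2]; its iterates converge geometrically to a fixed point.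
    The length of the interval depends only on the constants, which makes it
    uniform in the initial state. *)
Lemma picard_lindelof : exists y : R -> 'rV[R]_n,
  [/\ y a = q, forall t, `|y t - q| <= r,
      forall s t, `|y s - y t| <= M * `|s - t| &
      forall t i, a <= t <= a + d ->
        y t 0 i = q 0 i + \int[mu]_(s in `[a, t[) (X (y s) 0 i)].
Proof.
exists y; split; [|exact: good_y.1|exact: good_y.2|].
- apply/rowP => i; rewrite y_fix mxE clamp_id ?lexx ?lerDl//.
  by rewrite set_itv_ge ?bnd_simp ?ltxx// Rintegral_set0 addr0.
- by move=> t i tad; rewrite {1}y_fix mxE clamp_id.
Qed.

End Picard.


(** * Smooth maps and Lie derivatives *)

Section ContinuousSums.
Context {R : realType} {T : topologicalType}.
Implicit Types h : T -> R.

Lemma continuous_add h1 h2 : continuous h1 -> continuous h2 ->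
  continuous (fun x => h1 x + h2 x).
Proof. by move=> c1 c2 x; exact: (continuousD (c1 x) (c2 x)). Qed.

Lemma continuous_mul h1 h2 : continuous h1 -> continuous h2 ->
  continuous (fun x => h1 x * h2 x).
Proof. by move=> c1 c2 x; exact: (continuousM (c1 x) (c2 x)). Qed.

Lemma continuous_bigsum (I : Type) (s : seq I) (h : I -> T -> R) :
  (forall j, continuous (h j)) -> continuous (fun x => \sum_(j <- s) h j x).
Proof.
move=> hc; elim: s => [|j s IH].
  by under eq_fun do rewrite big_nil; exact: cst_continuous.
by under eq_fun do rewrite big_cons; exact: continuous_add.
Qed.

End ContinuousSums.

Section Smoothness.
Context {R : realType} {n : nat}.
Implicit Types (X : 'rV[R]_n -> 'rV[R]_n) (h : 'rV[R]_n -> R).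

Lemma is_Ck_differentiable (W : normedModType R) k (Y : 'rV[R]_n -> W) x :
  is_Ck k.+1 Y -> differentiable Y x.
Proof. by case=> + _; apply. Qed.

Lemma is_Ck_continuous (W : normedModType R) k (Y : 'rV[R]_n -> W) :
  is_Ck k Y -> continuous Y.
Proof.
case: k => // k Yk x; apply: differentiable_continuous.
exact: is_Ck_differentiable Yk.
Qed.

Lemma is_CkW (W : normedModType R) k (Y : 'rV[R]_n -> W) :
  is_Ck k.+1 Y -> is_Ck k Y.
Proof.
elim: k Y => [Y|k IH Y [dY Yk]]; first exact: is_Ck_continuous.
by split=> // v; exact: IH.
Qed.

Lemma derive_coord (y : 'rV[R]_n -> 'rV[R]_n) x v i : differentiable y x ->
  differentiable (fun z => y z 0 i) x /\
  'D_v (fun z => y z 0 i) x = 'D_v y x 0 i.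
Proof.
move=> dy; split.
  apply: (@differentiable_comp _ _ _ _ y (fun w : 'rV[R]_n => w 0 i)) => //.
  exact: differentiable_coord.
by rewrite derive_mx ?mxE//; exact: diff_derivable.
Qed.

Lemma is_Ck_coord k X i : is_Ck k X -> is_Ck k (fun x => X x 0 i).
Proof.
elim: k X => [X Xc|k IH X [dX Xk]]; first exact: continuous_coord.
split=> [x|v]; first by have [] := derive_coord 0 i (dX x).
rewrite (_ : (fun x => _) = (fun x => 'D_v X x 0 i)); first exact: (IH _ (Xk v)).
by apply/funext => x; have [] := derive_coord v i (dX x).
Qed.

Lemma is_C1_ext (h : 'rV[R]_n -> R) (dh : 'rV[R]_n -> 'rV[R]_n -> R) :
  (forall x, differentiable h x) -> (forall v x, 'D_v h x = dh v x) ->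
  (forall v, continuous (dh v)) -> is_Ck 1 h.
Proof.
move=> hd hE hc; split=> // v.
by have -> : (fun x => 'D_v h x) = dh v by apply/funext => x; exact: hE.
Qed.

Lemma is_C1D h1 h2 : is_Ck 1 h1 -> is_Ck 1 h2 ->
  is_Ck 1 (fun x => h1 x + h2 x).
Proof.
move=> [d1 c1] [d2 c2].
apply: (@is_C1_ext _ (fun v x => 'D_v h1 x + 'D_v h2 x)) => [x|v x|v].
- exact: differentiableD.
- by rewrite deriveD//; exact: diff_derivable.
- exact: (@continuous_add R 'rV[R]_n _ _ (c1 v) (c2 v)).
Qed.

Lemma is_C1M h1 h2 : is_Ck 1 h1 -> is_Ck 1 h2 ->
  is_Ck 1 (fun x => h1 x * h2 x).
Proof.
move=> C1 C2; have [d1 c1] := C1; have [d2 c2] := C2.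
apply: (@is_C1_ext _ (fun v x => h1 x * 'D_v h2 x + h2 x * 'D_v h1 x))
  => [x|v x|v].
- exact: differentiableM.
- by rewrite deriveM//; exact: diff_derivable.
- apply: (@continuous_add R 'rV[R]_n); apply: continuous_mul.
  + exact: (is_Ck_continuous C1).
  + exact: c2.
  + exact: (is_Ck_continuous C2).
  + exact: c1.
Qed.

Lemma is_C1_cst (c : R) : is_Ck 1 (fun _ : 'rV[R]_n => c).
Proof.
apply: (@is_C1_ext _ (fun v x => 0)) => [x|v x|v].
- exact: differentiable_cst.
- exact: derive_cst.
- exact: (@cst_continuous 'rV[R]_n R 0).
Qed.

Lemma is_C1_sum (I : Type) (s : seq I) (F : I -> 'rV[R]_n -> R) :
  (forall j, is_Ck 1 (F j)) -> is_Ck 1 (fun x => \sum_(j <- s) F j x).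
Proof.
move=> FC; elim: s => [|j s IH].
  by under eq_fun do rewrite big_nil; exact: is_C1_cst.
by under eq_fun do rewrite big_cons; exact: is_C1D.
Qed.

(** The continuity of all directional derivatives, which is what [is_Ck] gives,
    controls the differential through this finite sum. *)
Lemma diff_sum (W : normedModType R) (Y : 'rV[R]_n -> W) x v :
  differentiable Y x -> 'd Y x v = \sum_j v 0 j *: 'D_(delta_mx 0 j) Y x.
Proof.
move=> dY; rewrite {1}[v]row_sum_delta linear_sum.
by apply: eq_bigr => j _; rewrite linearZ/= deriveE.
Qed.

Lemma lie_continuous h X : is_Ck 1 h -> continuous X ->
  continuous (lie_derivative X h).
Proof.
move=> [dh ch] Xc; rewrite /lie_derivative.
under [fun x => _]eq_fun => x do rewrite diff_sum//.
apply: (@continuous_bigsum R 'rV[R]_n) => j.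
by apply: continuous_mul; [exact: continuous_coord|exact: ch].
Qed.

Lemma lie_sum h X x : differentiable h x ->
  lie_derivative X h x = \sum_j X x 0 j * 'D_(delta_mx 0 j) h x.
Proof. by move=> dh; rewrite /lie_derivative diff_sum. Qed.

Lemma lie_C1 h X : is_Ck 2 h -> is_Ck 1 X -> is_Ck 1 (lie_derivative X h).
Proof.
move=> [dh ch] XC.
rewrite (_ : lie_derivative X h = fun x => \sum_j X x 0 j * 'D_(delta_mx 0 j) h x).
  by apply: is_C1_sum => j; apply: is_C1M; [exact: is_Ck_coord|exact: ch].
by apply/funext => x; exact: lie_sum.
Qed.

Lemma lie_affine f g (c : R) h x : differentiable h x ->
  lie_derivative (fun z => f z + c *: g z) h x =
  lie_derivative f h x + c * lie_derivative g h x.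
Proof. by move=> dh; rewrite /lie_derivative linearD linearZ. Qed.

End Smoothness.

Section ChainRule.
Context {R : realType} {n : nat}.

Lemma is_derive_comp (h : 'rV[R]_n -> R) (y : R -> 'rV[R]_n) (t : R) v :
  differentiable h (y t) -> is_derive t 1 y v ->
  is_derive t (1 : R) (h \o y) ('d h (y t) v).
Proof.
move=> dh [dy vE].
have dy' : differentiable y t by exact/derivable1_diffP.
have dhy : differentiable (h \o y) t by exact: differentiable_comp.
apply: DeriveDef; first exact: diff_derivable.
by rewrite deriveE// diff_comp//= -vE deriveE.
Qed.

Lemma is_derive_line (h : 'rV[R]_n -> R) (x v : 'rV[R]_n) (s : R) :
  differentiable h (x + s *: v) ->
  is_derive s (1 : R) (fun s => h (x + s *: v)) ('D_v h (x + s *: v)).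
Proof.
move=> dh; rewrite deriveE//.
apply: (is_derive_comp (y := fun s => x + s *: v) dh).
have : is_derive s (1 : R) (cst x + (fun s : R => s *: v)) (0 + v).
  apply: is_deriveD; apply: DeriveDef.
    apply: diff_derivable; exact: ex_diff.
  by rewrite deriveE ?diff_val ?scale1r//; exact: ex_diff.
by rewrite add0r.
Qed.

Lemma MVT_line (h : 'rV[R]_n -> R) (x v : 'rV[R]_n) (s : R) : 0 < s ->
  (forall z, differentiable h z) ->
  exists2 c, 0 < c < s & h (x + s *: v) - h x = s * 'D_v h (x + c *: v).
Proof.
move=> s0 dh.
have [||c cs E] := @MVT R (fun s => h (x + s *: v))
  (fun s => 'D_v h (x + s *: v)) 0 s s0.
- by move=> c _; exact: is_derive_line.
- apply: continuous_subspaceT => z; apply: differentiable_continuous.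
  by apply/derivable1_diffP; have [] := is_derive_line (dh (x + z *: v)).
exists c; first by move: cs; rewrite in_itv.
by move: E; rewrite scale0r addr0 subr0 mulrC.
Qed.

End ChainRule.


(** * Symmetry of second derivatives and the Lie bracket *)

Section Bracket.
Context {R : realType} {n : nat}.
Implicit Types (X f g : 'rV[R]_n -> 'rV[R]_n) (h : 'rV[R]_n -> R).

Lemma near_closed_ball (p : 'rV[R]_n) (P : set 'rV[R]_n) :
  (\forall z \near p, P z) -> exists2 r : R, 0 < r &
  forall z, `|z - p| <= r -> P z.
Proof.
move=> /nbhs_normP[r r0 rP]; exists (r / 2); first exact: divr_gt0.
move=> z zp; apply: rP; rewrite /= distrC (le_lt_trans zp)//.
by rewrite ltr_pdivrMr// ltr_pMr// ltr1n.
Qed.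

Lemma continuous_closed_ball (h : 'rV[R]_n -> R) p (e : R) :
  continuous h -> 0 < e ->
  exists2 r : R, 0 < r & forall z, `|z - p| <= r -> `|h z - h p| <= e.
Proof.
move=> hc e0; apply: near_closed_ball.
have /cvgrPdist_le/(_ _ e0) := hc p.
by apply: filterS => z; rewrite distrC.
Qed.

(** Two applications of the mean value theorem turn the second difference over
    the parallelogram with sides [s *: v] and [s *: w] into [s ^+ 2] times a
    value of ['D_w ('D_v h)] at a point of the parallelogram. *)
Lemma second_difference h x v w (e : R) : is_Ck 2 h -> 0 < e ->
  exists2 d : R, 0 < d & forall s, 0 < s < d ->
    `|h (x + s *: w + s *: v) - h (x + s *: w) - h (x + s *: v) + h x
      - s ^+ 2 * 'D_w ('D_v h) x| <= e * s ^+ 2.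
Proof.
move=> [dh ch] e0.
have dvh : is_Ck 1 ('D_v h) by exact: ch.
have [r r0 Hr] := continuous_closed_ball x (dvh.2 w) e0.
have vw0 : 0 < `|v| + `|w| + 1 by rewrite ltr_wpDl// addr_ge0.
exists (r / (`|v| + `|w| + 1)); first exact: divr_gt0.
move=> s /andP[s0]; rewrite ltr_pdivlMr// => sr.
have [|| c] := @MVT R (fun t => h (x + s *: w + t *: v) - h (x + t *: v))
  (fun t => 'D_v h (x + s *: w + t *: v) - 'D_v h (x + t *: v)) 0 s s0.
- by move=> t _; apply: is_deriveB; exact: is_derive_line.
- apply: continuous_subspaceT => z; apply: differentiable_continuous.
  apply/derivable1_diffP; apply: derivableB.
    by have [] := is_derive_line (dh (x + s *: w + z *: v)).
  by have [] := is_derive_line (dh (x + z *: v)).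
rewrite in_itv/= => /andP[c0 cs]; rewrite !scale0r !addr0 subr0 => E.
have [c' /andP[c'0 c's] E'] := MVT_line (x + c *: v) w s0 dvh.1.
have -> : h (x + s *: w + s *: v) - h (x + s *: w) - h (x + s *: v) + h x =
   s ^+ 2 * 'D_w ('D_v h) (x + c *: v + c' *: w).
  rewrite expr2 -mulrA -E' mulrC (addrAC x (c *: v)) -E; ring.
rewrite -mulrBr normrM [leLHS]mulrC [`|s ^+ 2|]ger0_norm ?sqr_ge0//.
rewrite ler_wpM2r ?sqr_ge0//; apply: Hr.
have -> : x + c *: v + c' *: w - x = c *: v + c' *: w.
  by apply/rowP => k; rewrite !mxE; ring.
rewrite (le_trans (ler_normD _ _))// !normrZ !gtr0_norm//.
have H1 : c * `|v| <= s * `|v| by rewrite ler_wpM2r// ltW.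
have H2 : c' * `|w| <= s * `|w| by rewrite ler_wpM2r// ltW.
rewrite (le_trans (lerD H1 H2))//; lra.
Qed.

Lemma approx_sub (e D1 D2 S A B : R) : D1 = D2 ->
  `|D1 - S * A| <= e / 2 * S -> `|D2 - S * B| <= e / 2 * S ->
  `|S * (A - B)| <= S * e.
Proof.
move=> -> H1 H2; have -> : S * (A - B) = (D2 - S * B) - (D2 - S * A) by ring.
by rewrite (le_trans (ler_normB _ _))// (le_trans (lerD H2 H1))//; lra.
Qed.

(** The second difference is symmetric in [v] and [w], and divided by [s ^+ 2] it
    approximates both mixed derivatives. *)
Lemma schwarz h x v w : is_Ck 2 h -> 'D_w ('D_v h) x = 'D_v ('D_w h) x.
Proof.
move=> hC; apply/eqP; rewrite -subr_eq0 -normr_le0.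
apply/ler_addgt0Pl => e e0; rewrite addr0.
have [d1 d10 H1] := second_difference x v w hC (divr_gt0 e0 (ltr0n R 2)).
have [d2 d20 H2] := second_difference x w v hC (divr_gt0 e0 (ltr0n R 2)).
pose s := Num.min d1 d2 / 2.
have s0 : 0 < s by rewrite divr_gt0// lt_min d10.
have sm : s < Num.min d1 d2.
  by rewrite ltr_pdivrMr// ltr_pMr ?ltr1n// lt_min d10.
have /H1 {}H1 : 0 < s < d1 by rewrite s0 (lt_le_trans sm)// ge_min lexx.
have /H2 {}H2 : 0 < s < d2 by rewrite s0 (lt_le_trans sm)// ge_min lexx orbT.
have s20 : 0 < s ^+ 2 by rewrite exprn_gt0.
rewrite -(ler_pM2l s20) -[X in X * _ <= _](gtr0_norm s20) -normrM.
apply: approx_sub H1 H2; rewrite (addrAC x); congr (_ + _).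
by rewrite -!addrA; congr (_ + _); rewrite addrC.
Qed.

Lemma lie_lie f g h x : is_Ck 1 f -> is_Ck 1 g -> is_Ck 2 h ->
  lie_derivative f (lie_derivative g h) x =
  'd h x ('d g x (f x)) +
  \sum_j \sum_k g x 0 j * f x 0 k * 'D_(delta_mx 0 k) ('D_(delta_mx 0 j) h) x.
Proof.
move=> fC gC hC; have [dh ch] := hC.
have gE : lie_derivative g h =
    \sum_j ((fun z => g z 0 j) * 'D_(delta_mx 0 j) h).
  by apply/funext => z; rewrite lie_sum// fct_sumE.
have dg j : differentiable (fun z => g z 0 j) x.
  by have [] := derive_coord 0 j (gC.1 x).
have ddh j : differentiable ('D_(delta_mx 0 j) h) x by exact: (ch _).1.
rewrite {1}/lie_derivative -deriveE; last first.
  by rewrite gE; apply: differentiable_sum => j; apply: differentiableM.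
rewrite gE derive_sum; last first.
  by move=> j; apply: diff_derivable; apply: differentiableM.
rewrite diff_sum// -big_split/=; apply: eq_bigr => j _.
rewrite deriveM; [|exact: diff_derivable|exact: diff_derivable].
rewrite addrC -deriveE; last exact: gC.1.
have [_ ->] := derive_coord (f x) j (gC.1 x).
congr (_ + _); last by rewrite /GRing.scale/= mulrC.
rewrite deriveE// diff_sum// scaler_sumr; apply: eq_bigr => k _.
by rewrite /GRing.scale/= mulrA.
Qed.

(** In [lie_lie] the second derivatives of [h] form a bilinear expression in [f]
    and [g], which cancels by [schwarz]; the derivatives of [f] and [g] that
    remain are the bracket. *)
Lemma lie_bracketE f g h x : is_Ck 1 f -> is_Ck 1 g -> is_Ck 2 h ->
  lie_derivative (lie_bracket f g) h x =
  lie_derivative f (lie_derivative g h) x -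
  lie_derivative g (lie_derivative f h) x.
Proof.
move=> fC gC hC; rewrite !lie_lie//.
rewrite [X in _ - (_ + X)]exchange_big/=.
under [X in _ - (_ + X)]eq_bigr => j _ do under eq_bigr => k _ do
  rewrite schwarz// (mulrC (f x 0 k)).
by rewrite opprD addrACA subrr addr0 /lie_derivative /lie_bracket linearB.
Qed.

Lemma C1_locally_lipschitz X (p : 'rV[R]_n) : is_Ck 1 X ->
  exists r L : R, [/\ 0 < r, 0 <= L & forall z w,
    `|z - p| <= r -> `|w - p| <= r -> `|X z - X w| <= L * `|z - w|].
Proof.
move=> XC.
pose dX i j := 'D_(delta_mx 0 j) (fun z => X z 0 i).
have Xi i : is_Ck 1 (fun z => X z 0 i) by exact: is_Ck_coord.
have : \forall z \near p, forall i j, `|dX i j z| <= `|dX i j p| + 1.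
  have FF : Filter (nbhs p) by exact: (nbhs_filter (p : 'rV[R]_n)).
  apply: (@filter_forall _ _ _ _ FF) => i.
  apply: (@filter_forall _ _ _ _ FF) => j.
  have /cvgrPdist_le/(_ _ ltr01) := (Xi i).2 (delta_mx 0 j) p.
  apply: filterS => z; rewrite -/(dX i j p) -/(dX i j z) distrC => zp.
  by rewrite -lerBlDl (le_trans (lerB_dist _ _)).
move=> /near_closed_ball[r r0 Hr].
pose L := \sum_i \sum_j (`|dX i j p| + 1).
have L0 : 0 <= L by do 2 (apply: sumr_ge0 => ? _); rewrite addr_ge0.
exists r, L; split=> // z w zp wp.
apply: rV_norm_le => [|i]; first by rewrite mulr_ge0.
rewrite !mxE.
have [c /andP[c0 c1]] := MVT_line w (z - w) ltr01 (Xi i).1.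
rewrite scale1r (addrC w) subrK mul1r => ->.
rewrite deriveE; last exact: (Xi i).1.
rewrite diff_sum; last exact: (Xi i).1.
apply: (le_trans (ler_norm_sum _ _ _)).
apply: (@le_trans _ _ (\sum_j (`|dX i j p| + 1) * `|z - w|)).
  apply: ler_sum => j _; rewrite normrM mulrC.
  apply: ler_pM => //; last exact: rV_coord_le.
  apply: Hr.
  have -> : w + c *: (z - w) - p = (1 - c) *: (w - p) + c *: (z - p).
    by apply/rowP => k; rewrite !mxE; ring.
  rewrite (le_trans (ler_normD _ _))// !normrZ.
  rewrite [`|1 - c|]ger0_norm ?subr_ge0 ?(ltW c1)// [`|c|]gtr0_norm//.
  have H1 : (1 - c) * `|w - p| <= (1 - c) * r.
    by rewrite ler_wpM2l// subr_ge0 ltW.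
  have H2 : c * `|z - p| <= c * r by rewrite ler_wpM2l// ltW.
  rewrite (le_trans (lerD H1 H2))//; lra.
rewrite -mulr_suml ler_wpM2r// /L [leRHS](bigD1 i)//= lerDl.
by do 2 (apply: sumr_ge0 => ? _); rewrite addr_ge0.
Qed.

End Bracket.


(** * Controlled arcs *)

Section Arcs.
Context {R : realType} {n : nat}.
Notation mu := (@lebesgue_measure R).
Variables f g : 'rV[R]_n -> 'rV[R]_n.
Implicit Types (u : R -> R) (y : R -> 'rV[R]_n) (a b c : R).

Definition velocity u y (r : R) : 'rV[R]_n := f (y r) + u r *: g (y r).

(** Solutions are kept in integral form on absolute time intervals, so that
    restricting and concatenating them requires no time shift.  The integral
    is over [[a, t[], which makes the value of the control at the right end
    irrelevant, and the Lipschitz bound supplies the measurability of the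
    velocity. *)
Definition arc u y a b : Prop :=
  [/\ a <= b,
      measurable_fun setT u,
      exists M : R, forall r, a <= r < b -> `|u r| <= M,
      exists K : R, forall s t, a <= s <= b -> a <= t <= b ->
        `|y s - y t| <= K * `|s - t| &
      forall t i, a <= t <= b ->
        y t 0 i = y a 0 i + \int[mu]_(r in `[a, t[) (velocity u y r 0 i)].

Lemma arc_eq u u' y y' a b : measurable_fun setT u' ->
  (forall r, a <= r < b -> u r = u' r) ->
  (forall t, a <= t <= b -> y t = y' t) ->
  arc u y a b -> arc u' y' a b.
Proof.
move=> mu' uu' yy' [ab _ [M uM] [K yK] yE]; split=> //.
- by exists M => r rab; rewrite -uu'// uM.
- by exists K => s t sab tab; rewrite -!yy'// yK.
- move=> t i tab; rewrite -!yy' ?lexx// yE//; congr (_ + _).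
  apply: eq_Rintegral => r; rewrite inE/= in_itv/= => /andP[ar rt].
  have [_ tb] := andP tab.
  have rb := lt_le_trans rt tb.
  by rewrite /velocity uu' ?ar// yy' ?ar// ltW.
Qed.

Hypotheses (fc : continuous f) (gc : continuous g).

Lemma velocity_integrable u y a b M K t i : a <= b -> measurable_fun setT u ->
  (forall r, a <= r < b -> `|u r| <= M) ->
  (forall s t, a <= s <= b -> a <= t <= b -> `|y s - y t| <= K * `|s - t|) ->
  t <= b -> mu.-integrable `[a, t[ (EFin \o (fun r => velocity u y r 0 i)).
Proof.
move=> ab mu_ uM yK tb.
(* [z] is continuous on the whole line and agrees with [y] on [[a, b]]. *)
pose z r := y (clamp a b r).
have zK s t' : `|z s - z t'| <= `|K| * `|s - t'|.
  rewrite (le_trans (yK _ _ _ _)) ?clamp_itv//.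
  rewrite (@le_trans _ _ (`|K| * `|clamp a b s - clamp a b t'|))//.
    by rewrite ler_wpM2r// ler_norm.
  by rewrite ler_wpM2l// clamp_lip.
have zc : continuous z by exact: lipschitz_continuous zK.
have hzc (h : 'rV[R]_n -> 'rV[R]_n) : continuous h ->
    continuous (fun r => h (z r) 0 i).
  move=> hc; apply: (@continuous_coord R n R (fun r => h (z r))) => r.
  by apply: continuous_comp; [exact: zc|exact: hc].
have zE r : `[a, t[%classic r -> y r = z r.
  rewrite /= in_itv/= => /andP[ar rt]; rewrite /z clamp_id// ar/=.
  by rewrite ltW// (lt_le_trans rt).
have M0 : `[a, t[%classic !=set0 -> 0 <= M.
  move=> [r]; rewrite /= in_itv/= => /andP[ar rt].
  by rewrite (le_trans _ (uM r _))// ar (lt_le_trans rt).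
apply: (@le_integrable _ _ _ mu _ _ _
  (EFin \o (fun r => `|f (z r) 0 i| + M * `|g (z r) 0 i|))) => //.
- apply/measurable_EFinP.
  apply: (@eq_measurable_fun _ _ _ _ _
    (fun r => f (z r) 0 i + u r * g (z r) 0 i)).
    by move=> r /set_mem rat; rewrite /velocity !mxE zE.
  apply: measurable_funD; first last.
    apply: measurable_funM; first exact: measurable_funTS.
    by apply: measurable_funTS; apply: continuous_measurable_fun; exact: hzc.
  by apply: measurable_funTS; apply: continuous_measurable_fun; exact: hzc.
- move=> r rat; rewrite /= lee_fin /velocity zE// !mxE.
  have M0' : 0 <= M by apply: M0; exists r.
  rewrite [leRHS]ger0_norm ?addr_ge0 ?mulr_ge0//.
  rewrite (le_trans (ler_normD _ _))// lerD2l normrM ler_wpM2r// uM//.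
  by move: rat; rewrite /= in_itv/= => /andP[-> /lt_le_trans ->].
- apply: continuous_integrable_co; apply: continuous_add.
    by move=> r; apply: cvg_norm; exact: hzc.
  apply: continuous_mul; first exact: cst_continuous.
  by move=> r; apply: cvg_norm; exact: hzc.
Qed.

Lemma arc_integrable u y a b t i : arc u y a b -> t <= b ->
  mu.-integrable `[a, t[ (EFin \o (fun r => velocity u y r 0 i)).
Proof.
move=> [ab mu_ [M uM] [K yK] _] tb.
exact: (velocity_integrable i ab mu_ uM yK tb).
Qed.

Lemma arc_cut u y a b c : arc u y a c -> a <= b <= c ->
  arc u y a b /\ arc u y b c.
Proof.
move=> uy /andP[ab bc]; have [_ mu_ [M uM] [K yK] yE] := uy.
split; split=> //.
- by exists M => r /andP[ar rb]; rewrite uM// ar (lt_le_trans rb).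
- exists K => s t /andP[s1 s2] /andP[t1 t2].
  by rewrite yK// ?s1 ?t1 (le_trans _ bc).
- by move=> t i /andP[t1 t2]; rewrite yE// t1 (le_trans t2).
- by exists M => r /andP[br rc]; rewrite uM// (le_trans ab).
- exists K => s t /andP[s1 s2] /andP[t1 t2].
  by rewrite yK// ?s2 ?t2 (le_trans ab).
- move=> t i /andP[bt tc].
  rewrite (yE t) ?(le_trans ab)// (yE b) ?ab// -addrA -Rintegral_co_split//.
  exact: (arc_integrable _ uy).
Qed.

Lemma arc_cat u y a b c : arc u y a b -> arc u y b c -> arc u y a c.
Proof.
move=> uy1 uy2; have [ab mu_ [M1 uM1] [K1 yK1] yE1] := uy1.
have [bc _ [M2 uM2] [K2 yK2] yE2] := uy2.
have K10 s t : a <= s <= b -> a <= t <= b ->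
    `|y s - y t| <= (`|K1| + `|K2|) * `|s - t|.
  move=> sab tab; rewrite (le_trans (yK1 _ _ sab tab))// ler_wpM2r//.
  by rewrite ler_wpDr// ler_norm.
have K20 s t : b <= s <= c -> b <= t <= c ->
    `|y s - y t| <= (`|K1| + `|K2|) * `|s - t|.
  move=> sbc tbc; rewrite (le_trans (yK2 _ _ sbc tbc))// ler_wpM2r//.
  by rewrite ler_wpDl// ler_norm.
have K12 s t : a <= s <= b -> b <= t <= c ->
    `|y s - y t| <= (`|K1| + `|K2|) * `|s - t|.
  move=> sab tbc; rewrite -(subrKA (y b)) (le_trans (ler_normD _ _))//.
  have H1 : `|y s - y b| <= _ := K10 s b sab _.
  have H2 : `|y b - y t| <= _ := K20 b t _ tbc.
  rewrite (le_trans (lerD (H1 _) (H2 _))) ?lexx ?ab ?bc//.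
  move: sab tbc => /andP[_ sb] /andP[bt _].
  have st := le_trans sb bt.
  rewrite -mulrDr (distrC s b) (distrC b t) (distrC s t).
  rewrite (@ger0_norm _ (b - s)) ?subr_ge0//.
  rewrite (@ger0_norm _ (t - b)) ?subr_ge0//.
  rewrite (@ger0_norm _ (t - s)) ?subr_ge0//.
  by rewrite [b - s + _]addrC subrKA.
have uM r : a <= r < c -> `|u r| <= Num.max M1 M2.
  move=> /andP[ar rc]; rewrite le_max.
  have [rb|br] := ltP r b; first by rewrite uM1// ar.
  by rewrite uM2 ?br// orbT.
have yK s t : a <= s <= c -> a <= t <= c ->
    `|y s - y t| <= (`|K1| + `|K2|) * `|s - t|.
  move=> /andP[as_ sc] /andP[at_ tc].
  have [sb|bs] := leP s b; have [tb|bt] := leP t b.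
  + by apply: K10; rewrite ?as_ ?at_.
  + by apply: K12; rewrite ?as_ ?(ltW bt).
  + by rewrite distrC (distrC s); apply: K12; rewrite ?at_ ?(ltW bs).
  + by apply: K20; rewrite ?(ltW bs) ?(ltW bt).
have ac := le_trans ab bc.
split=> //; [by exists (Num.max M1 M2)|by exists (`|K1| + `|K2|)|].
move=> t i /andP[at_ tc]; have [tb|bt] := leP t b; first by rewrite yE1// at_.
rewrite yE2 ?(ltW bt)// yE1 ?ab ?lexx// -addrA -Rintegral_co_split// ?ltW//.
exact: (velocity_integrable i ac mu_ uM yK tc).
Qed.

End Arcs.


(** * Steering and integral curves *)

Section Steering.
Context {R : realType} {n : nat}.
Notation mu := (@lebesgue_measure R).
Variables f g : 'rV[R]_n -> 'rV[R]_n.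
Implicit Types (S : set 'rV[R]_n) (a b c : R) (p q x z : 'rV[R]_n).

Definition steer S a x b z : Prop := exists u y,
  [/\ arc f g u y a b, y a = x, y b = z & forall t, a <= t <= b -> S (y t)].

Lemma steer_sub S S' a x b z :
  S `<=` S' -> steer S a x b z -> steer S' a x b z.
Proof.
by move=> SS' [u [y [uy ya yb yS]]]; exists u, y; split=> // t /yS /SS'.
Qed.

Lemma steer_refl S a x : S x -> steer S a x a x.
Proof.
move=> Sx; exists (cst 0), (cst x); split=> //; split=> //.
- by exists 0 => r _; rewrite normr0.
- by exists 0 => s t _ _; rewrite subrr normr0 mul0r.
- move=> t i; rewrite -eq_le => /eqP <-.
  by rewrite set_itv_ge ?bnd_simp ?ltxx// Rintegral_set0 addr0.
Qed.

Lemma steer_end S a x b z : steer S a x b z -> S z.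
Proof. by move=> [u [y [[ab _ _ _ _] _ <- yS]]]; apply: yS; rewrite ab lexx. Qed.

Hypotheses (fc : continuous f) (gc : continuous g).

Lemma steer_trans S a x b w c z :
  steer S a x b w -> steer S b w c z -> steer S a x c z.
Proof.
move=> [u1 [y1 [uy1 y1a y1b y1S]]] [u2 [y2 [uy2 y2b y2c y2S]]].
have [[ab mu1 _ _ _] [bc mu2 _ _ _]] := (uy1, uy2).
pose u r := if r < b then u1 r else u2 r.
pose y t := if t <= b then y1 t else y2 t.
have mu_ : measurable_fun setT u.
  by apply: measurable_fun_ifT => //; exact: measurable_fun_ltr.
have y1E t : a <= t <= b -> y1 t = y t by rewrite /y => /andP[_ ->].
have y2E t : b <= t <= c -> y2 t = y t.
  rewrite /y => /andP[bt _]; case: leP => // tb.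
  have -> : t = b by apply/eqP; rewrite eq_le bt tb.
  by rewrite y1b y2b.
exists u, y; split.
- apply: (@arc_cat _ _ _ _ fc gc _ _ _ b).
    apply: (arc_eq mu_ _ y1E uy1).
    by move=> r /andP[_ rb]; rewrite /u rb.
  apply: (arc_eq mu_ _ y2E uy2).
  by move=> r /andP[br _]; rewrite /u ltNge br.
- by rewrite -y1E// lexx.
- by rewrite -y2E// lexx bc.
- move=> t /andP[at_ tc]; have [tb|bt] := leP t b.
    by rewrite -y1E ?at_//; apply: y1S; rewrite at_.
  by rewrite -y2E ?(ltW bt)//; apply: y2S; rewrite (ltW bt).
Qed.

Lemma steer_cut S a x b c z : steer S a x c z -> a <= b <= c ->
  exists w, steer S a x b w /\ steer S b w c z.
Proof.
move=> [u [y [uy ya yc yS]]] abc; have [ab bc] := andP abc.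
have [uy1 uy2] := arc_cut fc gc uy abc.
exists (y b); split; exists u, y; split=> //.
- by move=> t /andP[at_ tb]; apply: yS; rewrite at_ (le_trans tb).
- by move=> t /andP[bt tc]; apply: yS; rewrite tc (le_trans ab).
Qed.

(** The vector field that the constant control [v] produces. *)
Definition drift (v : R) z := f z + v *: g z.

Definition integral_curve v (y : R -> 'rV[R]_n) a d : Prop :=
  [/\ arc f g (cst v) y a (a + d), continuous y &
      forall t, a < t < a + d -> is_derive t (1 : R) y (drift v (y t))].

Lemma drift_continuous v : continuous (drift v).
Proof.
move=> z; apply: (@continuousD R 'rV[R]_n 'rV[R]_n f (v *: g)); first exact: fc.
by apply: (@continuousZr R 'rV[R]_n 'rV[R]_n); exact: gc.
Qed.

Lemma integral_curve_exists v q r M L a d :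
  0 <= M -> 0 <= L -> 0 <= d ->
  (forall z, `|z - q| <= r -> `|drift v z| <= M) ->
  (forall z w, `|z - q| <= r -> `|w - q| <= r ->
    `|drift v z - drift v w| <= L * `|z - w|) ->
  d * M <= r -> d * L <= 2^-1 ->
  exists y, [/\ integral_curve v y a d, y a = q & forall t, `|y t - q| <= r].
Proof.
move=> M0 L0 d0 XM XL dM dL.
have Xc := drift_continuous (v := v).
have [y [ya yr yM yE]] := picard_lindelof a M0 L0 d0 Xc XM XL dM dL.
have yc : continuous y by exact: lipschitz_continuous yM.
have Xyc i : continuous (fun s => drift v (y s) 0 i).
  apply: (@continuous_coord R n R (fun s => drift v (y s))) => t.
  by apply: continuous_comp; [exact: yc|exact: Xc].
exists y; split=> //; split=> //.
  split=> //; first by rewrite lerDl.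
  - by exists `|v|.
  - by exists M => s t _ _; exact: yM.
  - by move=> t i tad; rewrite yE// ya.
move=> t /andP[at_ td].
have H i : is_derive t (1 : R) (fun s => y s 0 i) (drift v (y t) 0 i).
  have Xint : mu.-integrable `[a, t + 1] (EFin \o (fun s => drift v (y s) 0 i)).
    apply: continuous_compact_integrable; first exact: segment_compact.
    exact: continuous_subspaceT.
  have [|||D DE] := @continuous_FTC1_closed R (fun s => drift v (y s) 0 i) a
    t (t + 1) _ Xint.
  + by rewrite ltrDl.
  + exact: at_.
  + exact: Xyc.
  rewrite derive1E in DE.
  apply: (@near_eq_is_derive _ _ _
    (cst (q 0 i) + (fun s => \int[mu]_(r in `[a, s]) (drift v (y r) 0 i)))).
    near=> s.
    rewrite yE; last first.
      by apply/andP; split; apply/ltW; near: s;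
        [exact: lt_nbhsr|exact: lt_nbhsl].
    congr (_ + _); rewrite Rintegral_itv_bndo_bndc//.
    exact: continuous_integrable_co.
  rewrite -[drift v (y t) 0 i]add0r -DE; apply: is_deriveD.
  exact: derivableP.
have dy : derivable y t 1.
  by apply/derivable_mxP => i j; rewrite ord1; have [] := H j.
apply: DeriveDef => //; rewrite derive_mx//; apply/rowP => i.
by rewrite mxE; have [_ ->] := H i.
Unshelve. all: by end_near. Qed.

(** Second-order estimates along a curve come from applying this twice: first
    to a Lie derivative of [h], with [K = 0], to bound it by an affine
    function of time, then to [h] itself. *)
Lemma quadratic_growth v y a d (h : 'rV[R]_n -> R) (k K : R) :
  integral_curve v y a d -> (forall z, differentiable h z) ->
  (forall t, a < t < a + d -> lie_derivative (drift v) h (y t) <= k + K * (t - a)) ->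
  forall t, a <= t <= a + d ->
    h (y t) <= h (y a) + k * (t - a) + K / 2 * (t - a) ^+ 2.
Proof.
move=> [_ yc yd] hd hk t /andP[]; rewrite le_eqVlt => /predU1P[<- _|at_ td].
  by rewrite subrr mulr0 expr0n/= mulr0 !addr0.
pose P := (cst k * (id - cst a) + cst (K / 2) * (id - cst a) ^+ 2 : R -> R).
have Pd c : is_derive c (1 : R) P (k + K * (c - a)).
  apply: is_derive_eq; rewrite /GRing.scale/= /cst /=.
  rewrite -[(id - (fun=> a)) c]/(c - a); lra.
have [||c + E] := @MVT R (h \o y - P)
  (fun c => 'd h (y c) (drift v (y c)) - (k + K * (c - a))) a t at_.
- move=> c; rewrite in_itv/= => /andP[ac ct].
  apply: is_deriveB; apply: is_derive_comp => //.
  by apply: yd; rewrite ac (lt_le_trans ct).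
- apply: continuous_subspaceT => c; apply: continuousB.
    apply: continuous_comp; first exact: yc.
    exact: differentiable_continuous.
  apply: differentiable_continuous; apply/derivable1_diffP.
  by have [] := Pd c.
rewrite in_itv/= => /andP[ac ct].
have := hk c; rewrite ac (lt_le_trans ct)//= => /(_ isT); rewrite -subr_le0 => H.
have : (h \o y - P) t - (h \o y - P) a <= 0.
  by rewrite E mulr_le0_ge0// subr_ge0 ltW.
rewrite -[(h \o y - P) t]/(h (y t) - (k * (t - a) + K / 2 * ((t - a) * (t - a)))).
rewrite -[(h \o y - P) a]/(h (y a) - (k * (a - a) + K / 2 * ((a - a) * (a - a)))).
rewrite expr2; lra.
Qed.

End Steering.


(** * Local decrease of the Lyapunov function *)

Section Descent.
Context {R : realType} {n : nat}.
Variables (f g : 'rV[R]_n -> 'rV[R]_n).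
Hypotheses (fC : is_Ck 1 f) (gC : is_Ck 1 g).
Implicit Types (a b d : R) (p q z : 'rV[R]_n).

Lemma normB_le p q z (r s : R) :
  `|z - q| <= r -> `|q - p| <= s -> `|z - p| <= r + s.
Proof.
by move=> zq qp; rewrite -(subrKA q) (le_trans (ler_normD _ _))// lerD.
Qed.

Lemma dist_le_add (x k e : R) : `|x - k| <= e -> x <= k + e.
Proof. by rewrite ler_norml lerBlDl => /andP[]. Qed.

Lemma double_le (r x : R) : r <= x / 2 -> r + r <= x. Proof. lra. Qed.

Lemma quadruple_le (r x : R) : r <= x / 4 -> 4 * r <= x. Proof. lra. Qed.

Lemma le_quadruple (r : R) : 0 < r ->
  [/\ r <= 4 * r, r + r <= 4 * r & r + r + (r + r) <= 4 * r].
Proof. by move=> r0; split; lra. Qed.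

Lemma second_order_decrease (s A w1 w2 w2' k11 k12 k22 F F1 F2 : R) : 0 < s ->
  w1 + w2 = 2 * A -> k11 / 2 + k12 + k22 / 2 = - 4 -> A <= s / 2 ->
  F1 <= F + w1 * s + (k11 + 1) / 2 * s ^+ 2 ->
  w2' <= w2 + (k12 + 1) * s ->
  F2 <= F1 + w2' * s + (k22 + 1) / 2 * s ^+ 2 ->
  F2 <= F - s ^+ 2.
Proof.
move=> s0 ww kk As H1 H2 H3.
have {}H2 : w2' * s <= (w2 + (k12 + 1) * s) * s by rewrite ler_wpM2r// ltW.
have H4 : (w1 + w2) * s <= s * s by rewrite ler_wpM2r ?(ltW s0)// ww; lra.
have H5 : (k11 / 2 + k12 + k22 / 2) * s ^+ 2 = - 4 * s ^+ 2 by rewrite kk.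
rewrite !expr2 in H1 H3 H5 *; lra.
Qed.

(** The second-order coefficients of [Phi] along the two legs, with controls [v]
    and [- v]: the three summands come from the first leg, from the change over
    the first leg of the rate of the second one, and from the second leg.  All
    terms but [2 * Af - v * (Bf - Ag)] cancel. *)
Lemma second_order_balance (Af Ag Bf Bg v : R) :
  v * (Bf - Ag) = 2 * Af + 4 ->
  (Af + v * Bf + v * (Ag + v * Bg)) / 2 +
  (Af + - v * Bf + v * (Ag + - v * Bg)) +
  (Af + - v * Bf + - v * (Ag + - v * Bg)) / 2 = - 4.
Proof. by move=> H; lra. Qed.

(** [f + v g] is bounded and Lipschitz near [p], so one existence time serves all
    the initial states of a small ball. *)
Lemma uniform_flow v p : exists2 rho : R, 0 < rho &
  forall r, 0 < r <= rho -> exists2 d0 : R, 0 < d0 &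
  forall q a d, `|q - p| <= r -> 0 <= d <= d0 -> exists y,
    [/\ integral_curve f g v y a d, y a = q & forall t, `|y t - q| <= r].
Proof.
have [rf [Lf [rf0 Lf0 fL]]] := C1_locally_lipschitz p fC.
have [rg [Lg [rg0 Lg0 gL]]] := C1_locally_lipschitz p gC.
pose L := Lf + `|v| * Lg.
pose rL := Num.min rf rg.
have rL0 : 0 < rL by rewrite lt_min rf0.
have L0 : 0 <= L by rewrite addr_ge0// mulr_ge0.
have XL z w : `|z - p| <= rL -> `|w - p| <= rL ->
    `|drift f g v z - drift f g v w| <= L * `|z - w|.
  rewrite !le_min => /andP[zf zg] /andP[wf wg].
  have -> : drift f g v z - drift f g v w = (f z - f w) + v *: (g z - g w).
    by rewrite /drift scalerBr opprD addrACA.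
  rewrite (le_trans (ler_normD _ _))// mulrDl lerD ?fL// normrZ -mulrA.
  by rewrite ler_wpM2l ?gL.
pose M := L * rL + `|drift f g v p|.
have M0 : 0 <= M by rewrite addr_ge0// mulr_ge0// ltW.
have XM z : `|z - p| <= rL -> `|drift f g v z| <= M.
  move=> zp; rewrite -[drift f g v z](subrK (drift f g v p)).
  rewrite (le_trans (ler_normD _ _))// lerD2r.
  by rewrite (le_trans (XL _ _ zp _)) ?subrr ?normr0 ?(ltW rL0)// ler_wpM2l.
exists (rL / 2); first exact: divr_gt0.
move=> r /andP[r0 rrL].
have M1 : 0 < M + 1 by rewrite ltr_wpDl.
have L1 : 0 < 2 * (L + 1) by rewrite mulr_gt0// ltr_wpDl.
exists (Num.min (r / (M + 1)) (2 * (L + 1))^-1).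
  by rewrite lt_min divr_gt0//= invr_gt0.
move=> q a d qp /andP[d0]; rewrite le_min => /andP[dM dL].
have qrL z : `|z - q| <= r -> `|z - p| <= rL.
  move=> zq; have := normB_le zq qp; move=> /le_trans; apply; lra.
apply: (integral_curve_exists (is_Ck_continuous fC) (is_Ck_continuous gC)
  a M0 L0 d0).
- by move=> z /qrL; exact: XM.
- by move=> z w /qrL zp /qrL wp; exact: XL.
- have : d * (M + 1) <= r by rewrite -ler_pdivlMr.
  apply: le_trans; rewrite ler_wpM2l//; lra.
- have : d * (2 * (L + 1)) <= 1 by rewrite -ler_pdivlMr// div1r.
  lra.
Qed.

Variable Phi : 'rV[R]_n -> R.
Hypothesis PhiC : is_Ck 2 Phi.

(** Descent with an amount [delta] that is uniform around [p], at the price of an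
    arbitrarily small temporary increase [eta]; this uniformity is what
    compactness can exploit. *)
Definition descends p := forall eta : R, 0 < eta ->
  exists rho delta : R, [/\ 0 < rho, 0 < delta &
    forall q a, `|q - p| <= rho -> exists b z,
      steer f g [set y | y != 0 /\ Phi y < Phi q + eta] a q b z /\
      Phi z <= Phi q - delta].

Let fc : continuous f. Proof. exact: is_Ck_continuous fC. Qed.
Let gc : continuous g. Proof. exact: is_Ck_continuous gC. Qed.
Let dPhi z : differentiable Phi z. Proof. exact: is_Ck_differentiable PhiC. Qed.

Let safe_ball p (eta : R) : p != 0 -> 0 < eta -> exists2 r : R, 0 < r &
  forall z q, `|z - p| <= r -> `|q - p| <= r -> z != 0 /\ Phi z < Phi q + eta.
Proof.
move=> p0 eta0.
have [r1 r10 Hr1] := continuous_closed_ball p (is_Ck_continuous PhiC)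
  (divr_gt0 eta0 (ltr0n R 3)).
have np : 0 < `|p| by rewrite normr_gt0.
exists (Num.min r1 (`|p| / 2)); first by rewrite lt_min r10 divr_gt0.
move=> z q; rewrite !le_min => /andP[z1 z2] /andP[q1 _]; split.
  apply/eqP => zE; move: z2; rewrite zE sub0r normrN; lra.
have := Hr1 _ z1; have := Hr1 _ q1; rewrite !ler_norml.
move=> /andP[H1 H2] /andP[H3 H4]; lra.
Qed.

(** The Lie derivative of [Phi] along [f + v g] stays below a negative constant
    near [p], and short integral curves stay near [p]. *)
Lemma descends_drift v p : p != 0 ->
  lie_derivative (drift f g v) Phi p < 0 -> descends p.
Proof.
move=> p0 Xp eta eta0.
have [rs rs0 Hs] := safe_ball p0 eta0.
pose al := - lie_derivative (drift f g v) Phi p / 2.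
have al0 : 0 < al by rewrite divr_gt0// oppr_gt0.
have [rX rX0 HX] := continuous_closed_ball p
  (lie_continuous (is_CkW PhiC) (drift_continuous fc gc (v := v))) al0.
have [rho rho0 flow] := uniform_flow v p.
pose r := Num.min rho (Num.min (rs / 2) (rX / 2)).
have r0 : 0 < r by rewrite !lt_min rho0 !divr_gt0.
have [rr rrs rrX] : [/\ r <= rho, r + r <= rs & r + r <= rX].
  have : r <= r by [].
  by rewrite {2}/r !le_min => /and3P[? /double_le ? /double_le ?].
have [d0 d00 fl] := flow r (introT andP (conj r0 rr)).
exists r, (al * d0); split=> //; first exact: mulr_gt0.
move=> q a qp.
have [|y [yI ya yq]] := fl q a d0 qp; first by rewrite lexx ltW.
have yp t : `|y t - p| <= r + r by exact: normB_le (yq t) qp.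
exists (a + d0), (y (a + d0)); split.
  exists (cst v), y; split=> //; first by have [] := yI.
  by move=> t _ /=; apply: Hs; [apply: le_trans rrs|apply: le_trans rrs; lra].
have Xy t : a < t < a + d0 ->
    lie_derivative (drift f g v) Phi (y t) <= - al + 0 * (t - a).
  move=> _; rewrite mul0r addr0.
  rewrite (le_trans (dist_le_add (HX _ (le_trans (yp t) rrX))))//.
  by rewrite /al; lra.
have := quadratic_growth yI dPhi Xy.
move=> /(_ (a + d0)); rewrite ya lerDl lexx ltW// => /(_ isT); lra.
Qed.

Lemma lie_comb X (h1 h2 : 'rV[R]_n -> R) c z :
  differentiable h1 z -> differentiable h2 z ->
  lie_derivative X (fun x => h1 x + c * h2 x) z =
  lie_derivative X h1 z + c * lie_derivative X h2 z.
Proof.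
move=> d1 d2; have d3 : differentiable (c \*: h2) z by exact: differentiableZ.
have D1 : derivable h1 z (X z) by exact: diff_derivable.
have D2 : derivable h2 z (X z) by exact: diff_derivable.
have D3 : derivable (c \*: h2) z (X z) by exact: diff_derivable.
rewrite /lie_derivative.
transitivity ('D_(X z) (h1 + c \*: h2) z).
  by rewrite deriveE//; exact: differentiableD.
by rewrite deriveD// deriveZ// !deriveE.
Qed.

(** Write [A = f Phi], [B = g Phi], so that [B] and [A] vanish at [p] and
    [[f,g] Phi = f B - g A].  With control [v] on a first leg of length [s] and
    [- v] on a second one, [Phi] changes by
    [2 s A(q) + s ^ 2 (2 f A - v (f B - g A))] up to a small multiple of [s ^ 2],
    and [v] is chosen so that the factor of [s ^ 2] equals [- 4].  The errors
    on the three derivatives involved are at most [1] each, which still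
    leaves [- 2 s ^ 2], and [2 s A(q) <= s ^ 2] for [q] close to [p]. *)
Lemma descends_bracket p : p != 0 ->
  lie_derivative f Phi p = 0 -> lie_derivative g Phi p = 0 ->
  lie_derivative (lie_bracket f g) Phi p != 0 -> descends p.
Proof.
move=> p0 fp gp; rewrite lie_bracketE//.
set A := lie_derivative f Phi; set B := lie_derivative g Phi.
set Af := lie_derivative f A p; set Ag := lie_derivative g A p.
set Bf := lie_derivative f B p; set Bg := lie_derivative g B p.
move=> D0 eta eta0.
have AC : is_Ck 1 A by exact: lie_C1.
have BC : is_Ck 1 B by exact: lie_C1.
(* With this [v] the balance [2 * Af - v * (Bf - Ag)] equals [- 4]. *)
pose v := (2 * Af + 4) / (Bf - Ag).
have vD : v * (Bf - Ag) = 2 * Af + 4 by rewrite /v divfK.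
pose w c z := A z + c * B z.
have wE c z : lie_derivative (drift f g c) Phi z = w c z by exact: lie_affine.
have wC c : is_Ck 1 (w c) by exact: is_C1D AC (is_C1M (is_C1_cst c) BC).
have dw c z : differentiable (w c) z by exact: is_Ck_differentiable (wC c).
pose K c e := Af + e * Bf + c * (Ag + e * Bg).
have KE c e : lie_derivative (drift f g c) (w e) p = K c e.
  rewrite /drift lie_affine// !lie_comb//;
    exact: is_Ck_differentiable AC || exact: is_Ck_differentiable BC.
have ball1 c e : exists2 r : R, 0 < r & forall z, `|z - p| <= r ->
    lie_derivative (drift f g c) (w e) z <= K c e + 1.
  have [r r0 Hr] := continuous_closed_ball p
    (lie_continuous (wC e) (drift_continuous fc gc (v := c))) (@ltr01 R).
  by exists r => // z /Hr; rewrite KE; exact: dist_le_add.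
have [r1 r10 H1] := ball1 v v.
have [r2 r20 H2] := ball1 v (- v).
have [r3 r30 H3] := ball1 (- v) (- v).
have [rs rs0 Hs] := safe_ball p0 eta0.
have [rho1 rho10 flow1] := uniform_flow v p.
have [rho2 rho20 flow2] := uniform_flow (- v) p.
pose r := Num.min (Num.min rho1 (rho2 / 2))
  (Num.min (rs / 4) (Num.min (r1 / 4) (Num.min (r2 / 4) (r3 / 4)))).
have r0 : 0 < r by rewrite !lt_min rho10 !divr_gt0.
have [rr1 rr2 rrs [rr_1 rr_2 rr_3]] : [/\ r <= rho1, r + r <= rho2,
    4 * r <= rs & [/\ 4 * r <= r1, 4 * r <= r2 & 4 * r <= r3]].
  have : r <= r by [].
  rewrite {2}/r !le_min => /and3P[/andP[? /double_le ?] /quadruple_le ?].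
  by move=> /and3P[/quadruple_le ? /quadruple_le ? /quadruple_le ?].
have [r1_4 r2_4 r3_4] := le_quadruple r0.
have [d1 d10 fl1] := flow1 r (introT andP (conj r0 rr1)).
have rr0 : 0 < r + r by rewrite addr_gt0.
have [d2 d20 fl2] := flow2 (r + r) (introT andP (conj rr0 rr2)).
pose s := Num.min d1 d2.
have s0 : 0 < s by rewrite lt_min d10.
have sd1 : 0 <= s <= d1 by rewrite ltW//= ge_min lexx.
have sd2 : 0 <= s <= d2 by rewrite ltW//= ge_min lexx orbT.
have [rA rA0 HA] := continuous_closed_ball p (is_Ck_continuous AC)
  (divr_gt0 s0 (ltr0n R 2)).
exists (Num.min r rA), (s ^+ 2); split; first by rewrite lt_min r0.
  by rewrite exprn_gt0.
move=> q a; rewrite le_min => /andP[qp qA].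
have [y1 [yI1 y1a y1q]] := fl1 q a s qp sd1.
have y1p t : `|y1 t - p| <= r + r by exact: normB_le (y1q t) qp.
have [y2 [yI2 y2a y2q]] := fl2 (y1 (a + s)) (a + s) s (y1p _) sd2.
have y2p t : `|y2 t - p| <= 4 * r.
  exact: le_trans (normB_le (y2q t) (y1p _)) r3_4.
exists (a + s + s), (y2 (a + s + s)); split.
  apply: (@steer_trans _ _ _ _ fc gc _ _ _ (a + s) (y1 (a + s))).
    exists (cst v), y1; split=> //; first by have [] := yI1.
    move=> t _ /=; apply: Hs; apply: le_trans rrs.
      exact: le_trans (y1p t) r2_4.
    exact: le_trans qp r1_4.
  exists (cst (- v)), y2; split=> //; first by have [] := yI2.
  move=> t _ /=; apply: Hs; apply: le_trans rrs; first exact: y2p.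
  exact: le_trans qp r1_4.
have e1 := quadratic_growth yI1 (dw v) (k := K v v + 1) (K := 0).
have e2 := quadratic_growth yI1 (dw (- v)) (k := K v (- v) + 1) (K := 0).
have e3 := quadratic_growth yI2 (dw (- v)) (k := K (- v) (- v) + 1) (K := 0).
have {}e1 t : a <= t <= a + s -> w v (y1 t) <= w v q + (K v v + 1) * (t - a).
  move=> /e1; rewrite y1a mul0r mul0r addr0; apply=> t' _; rewrite mul0r addr0.
  by apply: H1; apply: le_trans (le_trans (y1p t') r2_4) _.
have {}e2 t : a <= t <= a + s ->
    w (- v) (y1 t) <= w (- v) q + (K v (- v) + 1) * (t - a).
  move=> /e2; rewrite y1a mul0r mul0r addr0; apply=> t' _; rewrite mul0r addr0.
  by apply: H2; apply: le_trans (le_trans (y1p t') r2_4) _.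
have {}e3 t : a + s <= t <= a + s + s ->
    w (- v) (y2 t) <= w (- v) (y1 (a + s)) + (K (- v) (- v) + 1) * (t - (a + s)).
  move=> /e3; rewrite y2a mul0r mul0r addr0; apply=> t' _; rewrite mul0r addr0.
  by apply: H3; apply: le_trans (y2p t') _.
have E1 : Phi (y1 (a + s)) <= Phi q + w v q * s + (K v v + 1) / 2 * s ^+ 2.
  have := quadratic_growth yI1 dPhi (k := w v q) (K := K v v + 1).
  move=> /(_ _ (a + s)); rewrite y1a (_ : a + s - a = s); last first.
    by rewrite addrAC subrr add0r.
  apply.
    by move=> t /andP[? ?]; rewrite wE; apply: e1; rewrite !ltW.
  by rewrite lexx lerDl ltW.
have E2 : w (- v) (y1 (a + s)) <= w (- v) q + (K v (- v) + 1) * s.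
  have := e2 (a + s); rewrite lexx lerDl ltW// => /(_ isT).
  by rewrite (_ : a + s - a = s)//; rewrite addrAC subrr add0r.
have E3 : Phi (y2 (a + s + s)) <= Phi (y1 (a + s)) + w (- v) (y1 (a + s)) * s
    + (K (- v) (- v) + 1) / 2 * s ^+ 2.
  have := quadratic_growth yI2 dPhi (k := w (- v) (y1 (a + s)))
    (K := K (- v) (- v) + 1).
  move=> /(_ _ (a + s + s)).
  rewrite y2a (_ : a + s + s - (a + s) = s); last ring.
  apply; first by move=> t /andP[? ?]; rewrite wE; apply: e3; rewrite !ltW.
  by rewrite lexx lerDl ltW.
have Aq : A q <= s / 2.
  by have := HA q qA; rewrite [A p]fp subr0 ler_norml => /andP[].
have Ks : K v v / 2 + K v (- v) + K (- v) (- v) / 2 = - 4.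
  exact: second_order_balance vD.
have ww : w v q + w (- v) q = 2 * A q.
  by rewrite /w mulNr addrACA subrr addr0 -mulr2n mulr_natl.
exact: second_order_decrease s0 ww Ks Aq E1 E2 E3.
Qed.

End Descent.


(** * Uniform estimates on sublevel sets *)

Section Compactness.
Context {R : realType} {n : nat}.

(** Local constants become global on a compact set, provided that they may be
    decreased. *)
Lemma compact_uniform (A : set 'rV[R]_n) (P : R -> 'rV[R]_n -> Prop) :
  compact A ->
  (forall q d d', d' <= d -> P d q -> P d' q) ->
  (forall p, A p -> exists rho d : R, [/\ 0 < rho, 0 < d &
    forall q, `|q - p| <= rho -> P d q]) ->
  exists2 d : R, 0 < d & forall q, A q -> P d q.
Proof.
move=> /compact_near_coveringP/(_ R (0 : R)^'+ P _) H Pmono Ploc.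
have /H Hd : forall p, A p -> \forall q \near p & d \near (0 : R)^'+, P d q.
  move=> p /Ploc[rho [d [rho0 d0 Pq]]].
  exists ([set q : 'rV[R]_n | `|q - p| <= rho], [set d' | d' <= d]) => /=.
    split; last exact: nbhs_right_le.
    have : \forall q \near p, `|q - p| <= rho.
      by apply/nbhs_normP; exists rho => //= q /=; rewrite distrC => /ltW.
    exact.
  by move=> [q d'] /= [/Pq qd d'd]; exact: Pmono d'd qd.
have [d [d0 Pd]] := filter_ex (filterI (nbhs_right_gt (0 : R)) Hd).
by exists d.
Qed.

Variable Phi : 'rV[R]_n -> R.
Hypotheses (Phic : continuous Phi) (Phi_pd : positive_definite Phi)
  (Phi_proper : proper_map Phi).

Lemma Phi_ge0 x : 0 <= Phi x.
Proof.
have [->|/Phi_pd.2/ltW//] := eqVneq x 0.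
by rewrite Phi_pd.1.
Qed.

(** Properness makes [{Phi <= 1, e <= |z|}] compact, and [Phi] is positive there,
    hence bounded below by a positive constant. *)
Lemma Phi_small (e : R) : 0 < e ->
  exists2 c : R, 0 < c & forall z, Phi z <= c -> `|z| < e.
Proof.
move=> e0.
pose A := (Phi @^-1` `[0, 1]) `&` [set z | e <= `|z|].
have Ac : compact A.
  apply: compact_closedI; first by apply: Phi_proper; exact: segment_compact.
  apply: (@closed_comp _ _ (fun z : 'rV[R]_n => `|z|) [set y | e <= y]).
    by move=> z _; exact: norm_continuous.
  exact: closed_ge.
have [||c c0 cA] := @compact_uniform A (fun d q => d < Phi q) Ac.
- by move=> q d d' dd; exact: le_lt_trans.
- move=> p [_ /= ep].
  have p0 : p != 0 by rewrite -normr_gt0 (lt_le_trans e0).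
  have Pp := Phi_pd.2 p p0.
  have [r r0 Hr] := continuous_closed_ball p Phic (divr_gt0 Pp (ltr0n R 3)).
  exists r, (Phi p / 3); split=> //; first exact: divr_gt0.
  by move=> q /Hr; rewrite ler_norml => /andP[]; lra.
exists (Num.min c 1); first by rewrite lt_min c0 ltr01.
move=> z; rewrite le_min => /andP[zc z1].
rewrite ltNge; apply/negP => ez.
have /cA : A z by split=> //=; rewrite in_itv/= Phi_ge0.
by rewrite ltNge zc.
Qed.

End Compactness.

(** * Reaching small sublevel sets and waiting there *)

Section Reachability.
Context {R : realType} {n : nat}.
Variables (f g : 'rV[R]_n -> 'rV[R]_n) (Phi : 'rV[R]_n -> R).
Hypotheses (fC : is_Ck 1 f) (gC : is_Ck 1 g) (PhiC : is_Ck 2 Phi).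
Hypotheses (Phi_pd : positive_definite Phi) (Phi_proper : proper_map Phi).
Implicit Types (a b d : R) (p q z : 'rV[R]_n).

Let fc : continuous f. Proof. exact: is_Ck_continuous fC. Qed.
Let gc : continuous g. Proof. exact: is_Ck_continuous gC. Qed.
Let Phic : continuous Phi. Proof. exact: is_Ck_continuous PhiC. Qed.

(** When [g Phi] does not vanish, a constant control gives [Phi] the rate
    [- 1]. *)
Lemma descends_everywhere :
  (forall x, lie_derivative g Phi x = 0 -> x != 0 ->
     lie_derivative f Phi x < 0 \/
     lie_derivative f Phi x = 0 /\
     lie_derivative (lie_bracket f g) Phi x != 0) ->
  forall p, p != 0 -> descends f g Phi p.
Proof.
move=> Phi_dec p p0.
have dPhi : differentiable Phi p by exact: is_Ck_differentiable PhiC.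
have [g0|gN0] := eqVneq (lie_derivative g Phi p) 0.
  have [f0|[f0 D0]] := Phi_dec p g0 p0; last exact: descends_bracket.
  by apply: (@descends_drift _ _ _ _ fC gC _ PhiC 0); rewrite ?lie_affine// mul0r addr0.
apply: (@descends_drift _ _ _ _ fC gC _ PhiC
  (- (lie_derivative f Phi p + 1) / lie_derivative g Phi p)) => //.
by rewrite lie_affine// divfK// opprD addrA subrr add0r ltrN10.
Qed.

(** On the compact set [c <= Phi <= Phi x] the descents lower [Phi] by a common
    [d], so finitely many of them suffice; each starts no higher than [x] and
    overshoots by less than [b - Phi x]. *)
Lemma steer_to_sublevel : (forall p, p != 0 -> descends f g Phi p) ->
  forall x (c b a : R), x != 0 -> 0 < c -> Phi x < b ->
  exists e z, steer f g [set y | y != 0 /\ Phi y < b] a x e z /\ Phi z <= c.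
Proof.
move=> desc x c b a x0 c0 xb.
pose A := Phi @^-1` `[c, Phi x].
have Ac : compact A by apply: Phi_proper; exact: segment_compact.
have eta0 : 0 < b - Phi x by rewrite subr_gt0.
have A0 q : A q -> q != 0.
  rewrite /A /= in_itv/= => /andP[cq _]; apply/eqP => q0.
  by move: cq; rewrite q0 Phi_pd.1 leNgt c0.
have [||d d0 dA] := @compact_uniform _ _ A (fun d q => forall a, exists b' z,
    steer f g [set y | y != 0 /\ Phi y < Phi q + (b - Phi x)] a q b' z /\
    Phi z <= Phi q - d) Ac.
- move=> q d d' dd H a'; have [b' [z [qz zd]]] := H a'.
  by exists b', z; split=> //; rewrite (le_trans zd)// lerD2l lerN2.
- move=> p Ap; have [rho [d [rho0 d0 H]]] := desc p (A0 p Ap) _ eta0.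
  by exists rho, d; split=> // q qp a'; exact: H.
suff H m q a' : q != 0 -> Phi q <= Phi x -> Phi q <= c + d *+ m ->
    exists e z, steer f g [set y | y != 0 /\ Phi y < b] a' q e z /\ Phi z <= c.
  apply: (H (Num.truncn ((Phi x - c) / d)).+1) => //.
  rewrite -lerBlDl -mulr_natl -ler_pdivrMr//.
  exact/ltW/truncnS_gt.
elim: m q a' => [|m IH] q a' q0 qx.
  rewrite mulr0n addr0 => qc; exists a', q; split=> //.
  by apply: steer_refl; split=> //=; exact: le_lt_trans xb.
have [qc _|cq] := leP (Phi q) c.
  exists a', q; split=> //.
  by apply: steer_refl; split=> //=; exact: le_lt_trans xb.
move=> qm; have /dA/(_ a') [b' [w [qw wd]]] : A q.
  by rewrite /A /= in_itv/= (ltW cq).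
have [w0 _] := steer_end qw.
have wq : Phi w <= Phi q by rewrite (le_trans wd)// gerBl ltW.
have [||e [z [wz zc]]] := IH w b' w0.
- exact: le_trans qx.
- by rewrite (le_trans wd)// lerBlDr -addrA -mulrSr.
exists e, z; split=> //; apply: (steer_trans fc gc _ wz).
apply: steer_sub qw => y /= [y0 yb]; split=> //.
rewrite (lt_le_trans yb)//; lra.
Qed.

Hypothesis f0 : f 0 = 0.

(** Near the origin [|f z| <= L |z|], so in the ball of radius [|z| / 2] around
    [z] the speed is proportional to [|z|]: the time during which the solution
    surely stays in that ball does not depend on [z]. *)
Lemma coast_step : exists rho tau : R, [/\ 0 < rho, 0 < tau &
  forall z a d, z != 0 -> 2 * `|z| <= rho -> 0 <= d <= tau -> exists z',
    steer f g [set y | y != 0 /\ `|y| <= 2 * `|z|] a z (a + d) z'].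
Proof.
have [rho [L [rho0 L0 fL]]] := C1_locally_lipschitz 0 fC.
have L1 : 0 < 3 * (L + 1) by rewrite mulr_gt0// ltr_wpDl.
exists rho, (3 * (L + 1))^-1; split=> //; first by rewrite invr_gt0.
move=> z a d z0 zrho /andP[d0].
rewrite -div1r ler_pdivlMr// => dL.
have nz : 0 < `|z| by rewrite normr_gt0.
have dr v : drift f g 0 v = f v by rewrite /drift scale0r addr0.
have zw w : `|w - z| <= `|z| / 2 -> `|w| <= 3 / 2 * `|z|.
  move=> wz; rewrite -(subrK z w) (le_trans (ler_normD _ _))//; lra.
have wrho w : `|w - z| <= `|z| / 2 -> `|w - 0| <= rho.
  by move=> /zw; rewrite subr0 => /le_trans; apply; lra.
(* The speed in the ball is at most [3 / 2 * L * |z|], and [d <= 1 / (3 (L + 1))]. *)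
have [|||||y [[yI _ _] ya yz]] := @integral_curve_exists _ _ _ _ fc gc 0 z (`|z| / 2)
  (L * (3 / 2 * `|z|)) L a d _ L0 d0.
- by rewrite mulr_ge0// mulr_ge0.
- move=> w wz; rewrite dr -[f w]subr0 -f0.
  rewrite (le_trans (fL _ _ (wrho _ wz) _)) ?subrr ?normr0 ?(ltW rho0)//.
  by rewrite subr0 ler_wpM2l// zw.
- by move=> w1 w2 w1z w2z; rewrite !dr; apply: fL; exact: wrho.
- have : d * (3 * (L + 1)) * `|z| <= 1 * `|z| by rewrite ler_wpM2r.
  have : 0 <= d * `|z| by rewrite mulr_ge0.
  lra.
- lra.
exists (y (a + d)), (cst 0), y; split=> // t _ /=; split.
  apply/eqP => y0; have := yz t; rewrite y0 sub0r normrN; lra.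
by rewrite (le_trans (zw _ (yz t)))// ler_wpM2r//; lra.
Qed.

(** [N] successive steps of [coast_step] cover the time [sigma] and enlarge the
    norm at most by [2 ^ N]; they never reach the origin. *)
Lemma coast (sigma c : R) : 0 < c -> exists c' : R, [/\ 0 < c', c' <= c / 2 &
  forall z a d, z != 0 -> Phi z <= c' -> 0 <= d <= sigma -> exists z',
    steer f g [set y | y != 0 /\ Phi y < c] a z (a + d) z'].
Proof.
move=> c0; have [rho [tau [rho0 tau0 step]]] := coast_step.
have many N z a d : z != 0 -> 2 ^+ N * `|z| <= rho -> 0 <= d <= tau *+ N ->
    exists z', steer f g [set y | y != 0 /\ `|y| <= 2 ^+ N * `|z|] a z (a + d) z'.
  elim: N z a d => [|N IH] z a d z0.
    rewrite mulr0n -eq_le => _ /eqP <-; rewrite addr0; exists z.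
    by apply: steer_refl; rewrite /= expr0 mul1r.
  move=> zrho /andP[d0 dN].
  have z2 : 2 * `|z| <= 2 ^+ N.+1 * `|z|.
    by rewrite ler_wpM2r// exprS ler_peMr// exprn_ege1// ler1n.
  have [dt|td] := leP d tau.
    have [|z' zz'] := step z a d z0 (le_trans z2 zrho); first by rewrite d0.
    exists z'; apply: steer_sub zz' => y /= [y0 yz]; split=> //.
    exact: le_trans z2.
  have [|w zw] := step z a tau z0 (le_trans z2 zrho).
    by rewrite ltW//= lexx.
  have [w0 wz] := steer_end zw.
  have w2 : 2 ^+ N * `|w| <= 2 ^+ N.+1 * `|z|.
    by rewrite exprSr -mulrA ler_wpM2l// exprn_ge0.
  have [||z' wz'] := IH w (a + tau) (d - tau) w0.
  - exact: le_trans zrho.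
  - by rewrite subr_ge0 ltW//= lerBlDr -mulrSr.
  rewrite -addrA (addrC tau) subrK in wz'.
  exists z'; apply: (steer_trans fc gc (w := w) (b := a + tau)).
    by apply: steer_sub zw => y /= [y0 yz]; split=> //; exact: le_trans z2.
  by apply: steer_sub wz' => y /= [y0 yz]; split=> //; exact: le_trans w2.
pose N := (Num.truncn (sigma / tau)).+1.
have sN : sigma <= tau *+ N.
  by rewrite -mulr_natl -ler_pdivrMr//; exact/ltW/truncnS_gt.
have [r r0 Hr] := continuous_closed_ball 0 Phic (divr_gt0 c0 (ltr0n R 2)).
have N0 : 0 < 2 ^+ N :> R by rewrite exprn_gt0.
have e0 : 0 < Num.min rho r / 2 ^+ N by rewrite divr_gt0// lt_min rho0.
have [c1 c10 Hc1] := Phi_small Phic Phi_pd Phi_proper e0.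
exists (Num.min c1 (c / 2)); split.
- by rewrite lt_min c10 divr_gt0.
- by rewrite ge_min lexx orbT.
move=> z a d z0; rewrite le_min => /andP[/Hc1 zc _] /andP[d0 ds].
have : 2 ^+ N * `|z| <= Num.min rho r by rewrite mulrC -ler_pdivlMr// ltW.
rewrite le_min => /andP[zrho zr].
have [|z' zz'] := many N z a d z0 zrho; first by rewrite d0 (le_trans ds).
exists z'; apply: steer_sub zz' => y /= [y0 yz]; split=> //.
have := Hr y; rewrite subr0 Phi_pd.1 subr0 => /(_ (le_trans yz zr)).
by move=> /(le_trans (ler_norm _)) /le_lt_trans; apply; lra.
Qed.

End Reachability.


(** * Trajectories sampled on a regular grid *)

Section Sampling.
Context {R : realType} {n : nat}.
Notation mu := (@lebesgue_measure R).
Variables (f g : 'rV[R]_n -> 'rV[R]_n) (sigma : R).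
Hypotheses (fc : continuous f) (gc : continuous g) (sigma0 : 0 < sigma).

Definition grid (i : nat) : R := i%:R * sigma.

Definition period (r : R) : nat := Num.truncn (r / sigma).

Lemma grid0 : grid 0 = 0. Proof. by rewrite /grid mul0r. Qed.

Lemma gridS i : grid i.+1 = grid i + sigma.
Proof. by rewrite /grid -natr1 mulrDl mul1r. Qed.

Lemma grid_lt i : grid i < grid i.+1.
Proof. by rewrite gridS ltrDl. Qed.

Lemma grid_ge0 i : 0 <= grid i.
Proof. by rewrite mulr_ge0// ltW. Qed.

Lemma period_eq i r : grid i <= r < grid i.+1 -> period r = i.
Proof.
move=> /andP[ir ri]; have r0 : 0 <= r by exact: le_trans (grid_ge0 i) ir.
apply/eqP; rewrite /period truncn_eq ?divr_ge0 ?(ltW sigma0)//.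
by rewrite ler_pdivlMr// ltr_pdivrMr// ir.
Qed.

Lemma period_grid i : period (grid i) = i.
Proof. by apply: period_eq; rewrite lexx grid_lt. Qed.

Lemma period_itv r : 0 <= r -> grid (period r) <= r < grid (period r).+1.
Proof.
move=> r0; rewrite /grid -ler_pdivlMr// -ltr_pdivrMr//.
by apply: truncn_itv; rewrite divr_ge0// ltW.
Qed.

Lemma grid_ltn r : exists i, r < grid i.
Proof.
exists (period r).+1; rewrite /grid -ltr_pdivrMr//; exact: truncnS_gt.
Qed.

Lemma grid_cvg : grid i @[i --> \oo] --> +oo.
Proof.
apply/cvgryPge => A; have [N AN] := grid_ltn A.
exists N => // i /= Ni; rewrite (le_trans (ltW AN))// ler_wpM2r ?ler_nat//.
exact: ltW.
Qed.

Variables (U : nat -> 'rV[R]_n -> R -> R) (Y : nat -> 'rV[R]_n -> R -> 'rV[R]_n).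
Hypothesis stepP : forall i x, x != 0 ->
  [/\ arc f g (U i x) (Y i x) (grid i) (grid i.+1), Y i x (grid i) = x &
      Y i x (grid i.+1) != 0].

Fixpoint orbit x0 i : 'rV[R]_n :=
  if i is j.+1 then Y j (orbit x0 j) (grid j.+1) else x0.

Definition control x0 r := U (period r) (orbit x0 (period r)) r.

Definition trajectory x0 r : 'rV[R]_n :=
  if x0 == 0 then 0 else Y (period r) (orbit x0 (period r)) r.

(** The control planned for the period that starts at [s]; away from the grid
    it is never used. *)
Definition feedback (r s : R) x : 'rV[R]_1 :=
  if (x == 0) || (s != grid (period s)) then 0
  else const_mx (U (period s) x r).

Definition sampling_time (x : 'rV[R]_n) : R := if x == 0 then 0 else sigma.

Section Orbit.
Variables (x0 : 'rV[R]_n).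
Hypothesis x0N0 : x0 != 0.

Lemma orbit_neq0 i : orbit x0 i != 0.
Proof. by elim: i => [|i IH] //=; have [_ _ ->] := stepP i IH. Qed.

Lemma trajectoryE i r : grid i <= r <= grid i.+1 ->
  trajectory x0 r = Y i (orbit x0 i) r.
Proof.
rewrite /trajectory (negbTE x0N0) [r <= _]le_eqVlt => /andP[ir /predU1P[->|ri]].
  rewrite period_grid; have [_ + _] := stepP i.+1 (orbit_neq0 i.+1).
  by move=> ->.
by rewrite (@period_eq i)// ir.
Qed.

Lemma trajectory_grid i : trajectory x0 (grid i) = orbit x0 i.
Proof.
rewrite (@trajectoryE i); last by rewrite lexx ltW// grid_lt.
by have [] := stepP i (orbit_neq0 i).
Qed.

Lemma controlE i r : grid i <= r < grid i.+1 ->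
  control x0 r = U i (orbit x0 i) r.
Proof. by move=> /period_eq E; rewrite /control E. Qed.

Lemma control_measurable : measurable_fun setT (control x0).
Proof.
have mU i : measurable_fun setT (U i (orbit x0 i)).
  by have [[_ + _ _ _] _ _] := stepP i (orbit_neq0 i).
have -> : [set: R] = `]-oo, 0[ `|` \bigcup_i `[grid i, grid i.+1[%classic.
  apply/esym/seteqP; split=> // r _; have [r0|r0] := leP 0 r; last first.
    by left; rewrite /= in_itv.
  right; exists (period r) => //=; rewrite in_itv/=; exact: period_itv.
apply/measurable_funU => //; first exact: bigcup_measurable.
split.
  apply: (@eq_measurable_fun _ _ _ _ _ (U 0 (orbit x0 0))).
    move=> r; rewrite inE/= in_itv/= => r0; rewrite /control /period.
    have -> // : Num.truncn (r / sigma) = 0%N.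
    by apply/truncn0Pn; rewrite -ltNge ltr_pdivrMr// mul1r (lt_trans r0).
  exact: measurable_funTS.
apply/measurable_fun_bigcup => // i.
apply: (@eq_measurable_fun _ _ _ _ _ (U i (orbit x0 i))).
  by move=> r; rewrite inE/= in_itv/= => /controlE.
exact: measurable_funTS.
Qed.

Lemma trajectory_arc i : arc f g (control x0) (trajectory x0) 0 (grid i).
Proof.
elim: i => [|i IH].
  have [[_ _ _ [K _] _] _ _] := stepP 0 (orbit_neq0 0).
  rewrite grid0; split=> //; first exact: control_measurable.
  - by exists 0 => r /andP[r0 /(le_lt_trans r0)]; rewrite ltxx.
  - exists 0 => s t; rewrite -!eq_le => /eqP <- /eqP <-.
    by rewrite !subrr normr0 mul0r.
  - move=> t j; rewrite -eq_le => /eqP <-.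
    by rewrite set_itv_ge ?bnd_simp ?ltxx// Rintegral_set0 addr0.
apply: (arc_cat fc gc IH).
have [uy _ _] := stepP i (orbit_neq0 i).
apply: (arc_eq control_measurable _ _ uy) => r.
  by move=> /controlE ->.
by move=> /trajectoryE ->.
Qed.

End Orbit.

Let F (x : 'rV[R]_n) (u : 'rV[R]_1) := f x + u 0 0 *: g x.

Lemma trajectory_is_trajectory x0 : x0 != 0 ->
  is_trajectory F 0 x0 (fun r => const_mx (control x0 r)) (trajectory x0).
Proof.
move=> x0N0.
have FE i : (fun r => F (trajectory x0 r) (const_mx (control x0 r)) 0 i) =
    (fun r => velocity f g (control x0) (trajectory x0) r 0 i).
  by apply/funext => r; rewrite /F /velocity [const_mx _ _ _]mxE.
split.
  split=> [j|b].
    rewrite (_ : (fun z => _) = control x0); last first.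
      by apply/funext => r; rewrite mxE.
    by apply: measurable_funTS; exact: control_measurable.
  have [i bi] := grid_ltn b.
  have [_ _ [M uM] _ _] := trajectory_arc x0N0 i.
  exists `|M|; apply: aeW => r; rewrite /= in_itv/= => /andP[r0 rb].
  apply: rV_norm_le => // j; rewrite mxE (le_trans _ (ler_norm M))// uM//.
  by rewrite r0 (le_lt_trans rb).
move=> t j t0; have [i ti] := grid_ltn t.
have uy := trajectory_arc x0N0 i.
have It : mu.-integrable `[0, t]
    (EFin \o (fun r => velocity f g (control x0) (trajectory x0) r 0 j)).
  apply: integrableS (arc_integrable fc gc j uy (lexx _)) => //.
  by apply: subset_itvl; rewrite bnd_simp.
rewrite FE; split=> //.
have [_ _ _ _ ->] := uy; last by rewrite t0 ltW.
rewrite -{1}grid0 trajectory_grid//= Rintegral_itv_bndo_bndc//.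
by apply: integrableS It => //; apply: subset_itvl; rewrite bnd_simp.
Qed.

Lemma trajectory_sampled x0 : x0 != 0 ->
  sampled_trajectory F sampling_time feedback x0 grid (trajectory x0).
Proof.
move=> x0N0; split.
- exact: grid0.
- exact: grid_lt.
- exact: grid_cvg.
- move=> i; rewrite trajectory_grid// /sampling_time (negbTE (orbit_neq0 _ _))//.
  by rewrite gridS addrAC subrr add0r.
exists (fun r => const_mx (control x0 r)); last exact: trajectory_is_trajectory.
move=> i r /controlE ->; rewrite trajectory_grid// /feedback period_grid eqxx.
by rewrite (negbTE (orbit_neq0 _ _)).
Qed.

Lemma feedback_measurable x (D : set (measurableTypeR R * measurableTypeR R)) :
  measurable D -> measurable_vec D (fun ts => feedback ts.1 ts.2 x).
Proof.
move=> mD j; apply: measurable_funTS.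
have [->|x0] := eqVneq x 0.
  rewrite (_ : (fun z => _) = cst 0); first exact: measurable_cst.
  by apply/funext => z; rewrite /feedback eqxx mxE.
pose E i : set (measurableTypeR R * measurableTypeR R) := setT `*` [set grid i].
have mE i : measurable (E i) by apply: measurableX => //; exact: measurable_set1.
have mEU : measurable (\bigcup_i E i) by exact: bigcup_measurable.
rewrite -(setUv (\bigcup_i E i)); apply/measurable_funU => //.
  exact: measurableC.
split.
  apply/measurable_fun_bigcup => // i.
  apply: (@eq_measurable_fun _ _ _ _ _ (U i x \o fst)).
    move=> [r s]; rewrite inE => -[_ /= ->].
    by rewrite /feedback (negbTE x0) period_grid eqxx mxE.
  apply: measurable_funTS; apply: measurableT_comp; last exact: measurable_fst.
  by have [[_ + _ _ _] _ _] := stepP i x0.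
apply: (@eq_measurable_fun _ _ _ _ _ (fun=> 0 : R)); last exact: measurable_cst.
move=> [r s]; rewrite inE => sN; rewrite /feedback (negbTE x0)/=.
have -> : s != grid (period s); last by rewrite mxE.
by apply/eqP => sE; apply: sN; exists (period s).
Qed.

(** The feedback vanishes outside the null set of pairs whose second entry lies
    on the grid. *)
Lemma feedback_essentially_bounded x D :
  essentially_bounded (mu \x mu)%E D (fun ts => feedback ts.1 ts.2 x).
Proof.
pose G : set (measurableTypeR R) := range grid.
have Gc : countable G by apply: card_image_le.
have mG : measurable G by exact: countable_measurable.
exists 0; exists (setT `*` G); split.
- exact: measurableX.
- apply: (etrans (product_measure1E mu mu measurableT mG)).
  have G0 : mu G = 0%E by exact: countable_lebesgue_measure0.
  by apply: etrans (mule0 _); congr (_ * _)%E; exact: G0.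
- move=> [r s] /= H; split=> //=; apply: contrapT => sG; apply: H => _.
  rewrite /feedback; have -> : s != grid (period s).
    by apply/eqP => sE; apply: sG; exists (period s).
  by rewrite orbT normr0.
Qed.

End Sampling.


(** * Ranking the states *)

Section Ranking.
Context {R : realType} {n : nat}.
Variables (f g : 'rV[R]_n -> 'rV[R]_n) (Phi : 'rV[R]_n -> R) (sigma : R).
Hypotheses (fC : is_Ck 1 f) (gC : is_Ck 1 g) (PhiC : is_Ck 2 Phi).
Hypotheses (Phi_pd : positive_definite Phi) (Phi_proper : proper_map Phi).
Hypotheses (f0 : f 0 = 0) (sigma0 : 0 < sigma).
Hypothesis desc : forall p, p != 0 -> descends f g Phi p.

Let fc : continuous f. Proof. exact: is_Ck_continuous fC. Qed.
Let gc : continuous g. Proof. exact: is_Ck_continuous gC. Qed.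
Let Phic : continuous Phi. Proof. exact: is_Ck_continuous PhiC. Qed.

Lemma levels_exist : exists c : nat -> R, [/\ forall k, 0 < c k,
  forall k, c k.+1 <= c k / 2 &
  forall k z a d, z != 0 -> Phi z <= c k.+1 -> 0 <= d <= sigma -> exists z',
    steer f g [set y | y != 0 /\ Phi y < c k] a z (a + d) z'].
Proof.
have /choice[W HW] : forall c : R, exists c' : R, 0 < c -> [/\ 0 < c',
    c' <= c / 2 &
    forall z a d, z != 0 -> Phi z <= c' -> 0 <= d <= sigma -> exists z',
      steer f g [set y | y != 0 /\ Phi y < c] a z (a + d) z'].
  move=> c; have [c0|c0] := ltP 0 c; last by exists 0.
  by have [c' Hc'] := coast fC gC PhiC Phi_pd Phi_proper f0 sigma c0; exists c'.
pose c k := iter k W 1.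
have c0 k : 0 < c k.
  by elim: k => [|k IH]; rewrite ?ltr01//; have [] := HW _ IH.
by exists c; split=> // k; have [] := HW _ (c0 k).
Qed.

Variable c : nat -> R.
Hypotheses (c0 : forall k, 0 < c k) (cS : forall k, c k.+1 <= c k / 2).
Hypothesis c_coast : forall k z a d, z != 0 -> Phi z <= c k.+1 ->
  0 <= d <= sigma -> exists z',
    steer f g [set y | y != 0 /\ Phi y < c k] a z (a + d) z'.

Lemma level_le k l : (k <= l)%N -> c l <= c k.
Proof.
elim: l => [|l IH]; first by rewrite leqn0 => /eqP ->.
rewrite leq_eqVlt ltnS => /predU1P[->//|/IH]; apply: le_trans.
by have := cS l; have := c0 l; lra.
Qed.

Lemma level_small (e : R) : 0 < e -> exists k, c k.+1 < e.
Proof.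
move=> e0; have ck k : c k <= c 0 / 2 ^+ k.
  elim: k => [|k IH]; first by rewrite expr0 divr1.
  rewrite exprSr invfM mulrA (le_trans (cS k))//.
  by rewrite ler_wpM2r// invr_ge0.
have := cvg_geometric (c 0) (_ : `|2^-1 : R| < 1).
rewrite ger0_norm// invf_lt1// ltr1n => /(_ isT)/cvgrPdist_lt/(_ _ e0)[N _ HN].
exists N; rewrite (le_lt_trans (ck _))//.
have := HN N.+1 (leqnSn N); rewrite sub0r normrN /= exprVn.
by apply: le_lt_trans; exact: ler_norm.
Qed.

(** [layer 0] has no upper bound, so that every nonzero state has a layer. *)
Definition layer k : set 'rV[R]_n :=
  [set x | x != 0 /\ (k = 0%N \/ Phi x < c k)].

Lemma layer_sub k l : (k <= l)%N -> layer l `<=` layer k.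
Proof.
move=> kl x [x0 xl]; split=> //; case: xl => [l0|xl].
  by left; apply/eqP; rewrite -leqn0 -l0.
by right; rewrite (lt_le_trans xl)// level_le.
Qed.

Lemma rank_exists : exists rank : 'rV[R]_n -> nat, forall x, x != 0 ->
  layer (rank x) x /\ forall k, layer k x -> (k <= rank x)%N.
Proof.
suff /choice[rank Hr] : forall x : 'rV[R]_n, exists r, x != 0 ->
    layer r x /\ forall k, layer k x -> (k <= r)%N by exists rank.
move=> x; have [->|x0] := eqVneq x 0; first by exists 0%N.
have [m cm] := level_small (Phi_pd.2 x x0).
have ub k : `[< layer k x >] -> (k <= m)%N.
  move=> /asboolP[_ [->//|xk]]; rewrite leqNgt; apply/negP => mk.
  by have := lt_trans (lt_le_trans xk (level_le mk)) cm; rewrite ltxx.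
have ex : exists k, `[< layer k x >].
  by exists 0%N; apply/asboolP; split=> //; left.
have [r /asboolP rx rmax] := ex_maxnP ex ub.
by exists r => _; split=> // k /asboolP; exact: rmax.
Qed.

Variable rank : 'rV[R]_n -> nat.
Hypothesis rank_layer : forall x, x != 0 -> layer (rank x) x.
Hypothesis rank_max : forall k x, layer k x -> (k <= rank x)%N.

(** The target is two levels below, because waiting there must end one level
    below the present one. *)
Definition sinks i x N := exists e z, [/\ e <= grid sigma i + sigma *+ N,
  steer f g (layer (rank x)) (grid sigma i) x e z & Phi z <= c (rank x).+2].

Lemma cost_exists : exists cost : nat -> 'rV[R]_n -> nat,
  forall i x, x != 0 -> sinks i x (cost i x) /\
    forall N, sinks i x N -> (cost i x <= N)%N.
Proof.
suff /choice[C HC] : forall ix : nat * 'rV[R]_n, exists N, ix.2 != 0 ->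
    sinks ix.1 ix.2 N /\ forall M, sinks ix.1 ix.2 M -> (N <= M)%N.
  by exists (fun i x => C (i, x)) => i x; exact: (HC (i, x)).
move=> [i x] /=; have [->|x0] := eqVneq x 0; first by exists 0%N.
pose b := if rank x == 0%N then Phi x + 1 else c (rank x).
have xb : Phi x < b.
  rewrite /b; case: eqVneq => [_|k0]; first by rewrite ltrDl.
  by have [_ [/eqP|//]] := rank_layer x0; rewrite (negbTE k0).
have [e [z [xz zc]]] := steer_to_sublevel fC gC Phi_pd Phi_proper desc
  (grid sigma i) x0 (c0 (rank x).+2) xb.
have ex : exists N, `[< sinks i x N >].
  exists (Num.truncn ((e - grid sigma i) / sigma)).+1; apply/asboolP.
  exists e, z; split=> //.
    rewrite -lerBlDl -mulr_natl -ler_pdivrMr//; exact/ltW/truncnS_gt.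
  apply: steer_sub xz => y [y0 yb]; split=> //.
  by move: yb; rewrite /b; case: eqVneq; [left|right].
have [N /asboolP HN Nmin] := ex_minnP ex.
by exists N => _; split=> // M /asboolP; exact: Nmin.
Qed.

Variable cost : nat -> 'rV[R]_n -> nat.
Hypothesis cost_sinks : forall i x, x != 0 -> sinks i x (cost i x).
Hypothesis cost_min : forall i x N, x != 0 -> sinks i x N -> (cost i x <= N)%N.

(** Lexicographic progress: a deeper layer, or the same layer with a cheaper
    descent ahead. *)
Definition progress i x x' := (rank x < rank x')%N \/
  rank x' = rank x /\ (cost i.+1 x' < cost i x)%N.

(** A descent that ends within the period is completed by waiting, which leads to
    a deeper layer.  A longer one is cut at the end of the period: what is left
    of it bounds the cost of the state reached there, unless this state lies
    in a deeper layer. *)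
Lemma ranked_step i x : x != 0 -> exists x',
  steer f g (layer (rank x)) (grid sigma i) x (grid sigma i.+1) x' /\
  progress i x x'.
Proof.
move=> x0; have [e [z [eN xz zc]]] := cost_sinks i x0.
have [z0 _] := steer_end xz.
have ae : grid sigma i <= e by have [u [y [[]]]] := xz.
have [ea|ae'] := leP e (grid sigma i.+1).
  have [|x' zx'] := c_coast (k := (rank x).+1) (d := grid sigma i.+1 - e) e z0 zc.
    by rewrite subr_ge0 ea/= gridS lerBlDr addrC lerD2l.
  rewrite addrC subrK in zx'.
  have zx1 : steer f g (layer (rank x).+1) e z (grid sigma i.+1) x'.
    by apply: steer_sub zx' => y [y0 yc]; split=> //; right.
  exists x'; split; last by left; apply: rank_max; exact: steer_end zx1.
  apply: (steer_trans fc gc xz); apply: steer_sub zx1.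
  exact: layer_sub.
have [|w [xw wz]] := steer_cut fc gc xz (b := grid sigma i.+1).
  by rewrite (ltW ae') ltW// grid_lt.
exists w; split=> //; have wl := steer_end xw.
have w0 : w != 0 by case: wl.
have := rank_max wl; rewrite leq_eqVlt => /predU1P[rw|]; last by left.
right; split=> //.
case: (cost i x) eN => [|N] eN.
  move: eN; rewrite mulr0n addr0 leNgt (lt_trans _ ae')//.
  exact: grid_lt.
rewrite ltnS; apply: cost_min => //; exists e, z; rewrite -rw; split=> //.
by rewrite gridS -addrA -mulrS.
Qed.

End Ranking.


(** * Stabilization *)

Theorem proposition2 (R : realType) (n : nat)
    (f g : 'rV[R]_n -> 'rV[R]_n) (Phi : 'rV[R]_n -> R)
    (f0 : f 0 = 0) (f_C2 : is_Ck 2 f) (g_C2 : is_Ck 2 g)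
    (Phi_C2 : is_Ck 2 Phi) (Phi_pd : positive_definite Phi)
    (Phi_proper : proper_map Phi)
    (Phi_dec : forall x : 'rV[R]_n,
       lie_derivative g Phi x = 0 -> x != 0 ->
       lie_derivative f Phi x < 0 \/
       (lie_derivative f Phi x = 0 /\
        lie_derivative (lie_bracket f g) Phi x != 0)) :
  sdf_wgas (fun (x : 'rV[R]_n) (u : 'rV[R]_1) => f x + u 0 0 *: g x).
Proof.
move=> sigma sigma0.
have fC : is_Ck 1 f by exact: is_CkW.
have gC : is_Ck 1 g by exact: is_CkW.
have fc := is_Ck_continuous fC; have gc := is_Ck_continuous gC.
have Phic := is_Ck_continuous Phi_C2.
have desc := descends_everywhere fC gC Phi_C2 Phi_dec.
have [c [c0 cS c_coast]] :=
  levels_exist sigma fC gC Phi_C2 Phi_pd Phi_proper f0.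
have [rank rankP] := rank_exists Phi_pd c0 cS.
have rank_layer x : x != 0 -> layer Phi c (rank x) x by move=> /rankP[].
have rank_max k x : layer Phi c k x -> (k <= rank x)%N.
  by move=> kx; apply: (rankP x _).2 => //; case: kx.
have [cost costP] := cost_exists fC gC Phi_pd Phi_proper sigma0 desc
  c0 rank_layer.
have cost_sinks i x : x != 0 -> sinks f g Phi sigma c rank i x (cost i x).
  by move=> /(costP i)[].
have cost_min i x N : x != 0 -> sinks f g Phi sigma c rank i x N ->
    (cost i x <= N)%N by move=> /(costP i)[_]; apply.
have step := ranked_step fC gC sigma0 c0 cS c_coast rank_max cost_sinks cost_min.
have /choice[UY HUY] : forall ix : nat * 'rV[R]_n,
    exists uy : (R -> R) * (R -> 'rV[R]_n), ix.2 != 0 ->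
    [/\ arc f g uy.1 uy.2 (grid sigma ix.1) (grid sigma ix.1.+1),
      uy.2 (grid sigma ix.1) = ix.2,
      forall t, grid sigma ix.1 <= t <= grid sigma ix.1.+1 ->
        layer Phi c (rank ix.2) (uy.2 t) &
      progress rank cost ix.1 ix.2 (uy.2 (grid sigma ix.1.+1))].
  move=> [i x] /=; have [->|x0] := eqVneq x 0; first by exists (cst 0, cst 0).
  have [x' [[u [y [uy ya yb yS]]] prog]] := step i x x0.
  by exists (u, y) => _ /=; split=> //; rewrite yb.
pose U i x := (UY (i, x)).1; pose Y i x := (UY (i, x)).2.
have le_grid i : grid sigma i <= grid sigma i.+1 by rewrite ltW// grid_lt.
have stepP i x : x != 0 ->
    [/\ arc f g (U i x) (Y i x) (grid sigma i) (grid sigma i.+1),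
      Y i x (grid sigma i) = x & Y i x (grid sigma i.+1) != 0].
  move=> x0; have [arcUY Ya YS _] := HUY (i, x) x0; split=> //.
  by have [] := YS (grid sigma i.+1); rewrite ?le_grid ?lexx.
pose sol := trajectory sigma Y.
pose X x0 i := orbit sigma Y x0 i.
have XN0 x0 i : x0 != 0 -> X x0 i != 0 by move=> x00; exact: orbit_neq0 stepP _ _ _.
have prog x0 i : x0 != 0 -> progress rank cost i (X x0 i) (X x0 i.+1).
  by move=> x00; have [] := HUY (i, X x0 i) (XN0 x0 i x00).
have rank_mono x0 i j : x0 != 0 -> (i <= j)%N -> (rank (X x0 i) <= rank (X x0 j))%N.
  move=> x00; elim: j => [|j IH]; first by rewrite leqn0 => /eqP ->.
  rewrite leq_eqVlt ltnS => /predU1P[->//|/IH /leq_trans]; apply.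
  by have [/ltnW|[->]] := prog x0 j x00.
(* Within a layer the cost decreases at each period, so no layer is kept
   forever. *)
have rank_grows x0 i : x0 != 0 -> exists j, (rank (X x0 i) < rank (X x0 j))%N.
  move=> x00; have [m] := ubnP (cost i (X x0 i)).
  elim: m i => // m IH i; rewrite ltnS => im.
  have [H|[H1 H2]] := prog x0 i x00; first by exists i.+1.
  by have [|j Hj] := IH i.+1; [exact: leq_trans im|exists j; rewrite -H1].
have rank_unbounded x0 K : x0 != 0 -> exists i, (K <= rank (X x0 i))%N.
  move=> x00; elim: K => [|K [i Ki]]; first by exists 0%N.
  by have [j ij] := rank_grows x0 i x00; exists j; exact: leq_ltn_trans ij.
have sol_layer x0 i r : x0 != 0 -> grid sigma i <= r ->
    layer Phi c (rank (X x0 i)) (sol x0 r).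
  move=> x00 ir; have r0 : 0 <= r by apply: le_trans ir; exact: grid_ge0.
  have /andP[jr rj] := period_itv sigma0 r0.
  have ij : (i <= period sigma r)%N.
    rewrite -ltnS -(ltr_nat R) -(ltr_pM2r sigma0).
    exact: le_lt_trans ir rj.
  apply: (layer_sub c0 cS (rank_mono x0 _ _ x00 ij)).
  rewrite /sol (trajectoryE sigma0 stepP x00 (i := period sigma r)) ?jr ?ltW//.
  have [_ _ YS _] := HUY (period sigma r, X x0 (period sigma r)) (XN0 _ _ x00).
  by apply: YS; rewrite /= jr ltW.
have layer_small (e : R) : 0 < e -> exists K, forall x,
    layer Phi c K.+1 x -> `|x| < e.
  move=> e0; have [d d0 Hd] := Phi_small Phic Phi_pd Phi_proper e0.
  have [K cK] := level_small cS d0.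
  by exists K => x [_ [//|xK]]; apply: Hd; rewrite ltW// (lt_trans xK).
have sol0 : sol 0 = fun=> 0 by apply/funext => r; rewrite /sol /trajectory eqxx.
exists (sampling_time sigma), (feedback sigma U); split.
  split.
  - by move=> x; rewrite /sampling_time; case: ifP => // _; exact: ltW.
  - by rewrite /sampling_time eqxx.
  - by move=> x x0; rewrite /sampling_time (negbTE x0).
  - by move=> t s _ _; rewrite /feedback eqxx.
  - move=> x; split; last exact: feedback_essentially_bounded.
    apply: (feedback_measurable sigma0 stepP); apply: measurableX => //.
exists (fun=> grid sigma), sol; split.
- by move=> x0 x00; exact: (trajectory_sampled fc gc sigma0 stepP x00).
- rewrite sol0; split.
    split=> [j|b]; last by exists 0; apply: aeW => r _; rewrite normr0.
    rewrite (_ : (fun z => _) = fun=> 0 : R); first exact: measurable_cst.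
    by apply/funext => r; rewrite mxE.
  move=> t i t0.
  have -> : (fun r : R => (f 0 + (0 : 'rV[R]_1) 0 0 *: g 0) 0 i) = (fun=> 0 : R).
    by apply/funext => r; rewrite f0 !mxE mul0r addr0.
  split; first exact: integrable0.
  by rewrite Rintegral_cst//= mul0r addr0.
- move=> e e0; have [K HK] := layer_small e e0.
  have [d d0 Hd] := continuous_closed_ball 0 Phic (divr_gt0 (c0 K.+1) (ltr0n R 2)).
  exists d => // x0 x0d r r0.
  have [->|x00] := eqVneq x0 0; first by rewrite sol0 normr0 ltW.
  apply/ltW/HK; apply: (layer_sub c0 cS (l := rank (X x0 0))).
    apply: rank_max; split=> //; right => /=.
    have := Hd x0; rewrite subr0 Phi_pd.1 subr0 => /(_ x0d).
    move=> /(le_trans (ler_norm _)) /le_lt_trans; apply.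
    by rewrite ltr_pdivrMr// ltr_pMr// ltr1n.
  by apply: sol_layer => //; rewrite grid0.
- move=> x0; have [->|x00] := eqVneq x0 0; first by rewrite sol0; exact: cvg_cst.
  apply/cvgrPdist_le => e e0; have [K HK] := layer_small e e0.
  have [i Ki] := rank_unbounded x0 K.+1 x00.
  exists (grid sigma i); split; first exact: num_real.
  move=> r ir; rewrite sub0r normrN; apply/ltW/HK.
  by apply: (layer_sub c0 cS Ki); apply: sol_layer => //; exact: ltW.
Qed.
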